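(* Let $k$ be a positive integer and let $\mu_1, \nu_1, \mu_2, \nu_2 \in \mathcal{D}_{\mathrm{alg}}(k)$, where $\mu_1$ and $\mu_2$ are tracial. If we denote $$(\mu_1,\nu_1) \boxplus_c (\mu_2,\nu_2) = (\mu,\nu) \in \mathcal{D}_{\mathrm{alg}}(k)\times \mathcal{D}_{\mathrm{alg}}(k),$$ then it follows that $$(\mu_1,\Psi_k(\nu_1)) \boxplus_B (\mu_2,\Psi_k(\nu_2)) = (\mu,\Psi_k(\nu)) \in \mathcal{D}_{\mathrm{alg}}(k)\times \mathcal{D}'_{\mathrm{alg}}(k).$$
   Context: Distributions. $\mathbb{C}\langle X_1,\ldots,X_k\rangle$ is the algebra of polynomials in non-commuting indeterminates. $\mathcal{D}_{\mathrm{alg}}(k)$ is the set of linear functionals $\mu$ on it with $\mu(1)=1$, and $\mathcal{D}'_{\mathrm{alg}}(k)$ is the set of linear functionals $\mu'$ on it with $\mu'(1)=0$. $\mu$ is tracial if $\mu(PQ)=\mu(QP)$ for all $P,Q$. Partitions. $NC(n)$ is the set of non-crossing partitions of $\{1,\ldots,n\}$; $\mathrm{Int}(n)\subseteq NC(n)$ is the set of interval partitions (every block is a set of consecutive integers). A block $V$ of $\pi\in NC(n)$ is inner if there is a block $W$ of $\pi$ with $\min W<\min V\le\max V<\max W$; otherwise it is outer. For $M=\{i_1<\cdots<i_m\}\subseteq\{1,\ldots,n\}$, $(x_1,\ldots,x_n)\mid M:=(x_{i_1},\ldots,x_{i_m})$. Cumulants. Let $\mathcal{A}=\mathbb{C}\langle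 X_1,\ldots,X_k\rangle$, let $\mu,\nu\in\mathcal{D}_{\mathrm{alg}}(k)$ and $\mu'\in\mathcal{D}'_{\mathrm{alg}}(k)$. The following families of multilinear functionals $\mathcal{A}^n\to\mathbb{C}$, $n\ge1$, are uniquely determined by the stated identities, required for all $n\geq 1$ and $x_1,\ldots,x_n\in\mathcal{A}$. - Free cumulants $\kappa_{n;\mu}$ of $\mu$: $\mu(x_1\cdots x_n)=\sum_{\pi\in NC(n)}\prod_{V\in\pi}\kappa_{|V|;\mu}((x_1,\ldots,x_n)\mid V)$. - Boolean cumulants $\beta_{n;\nu}$ of $\nu$: $\nu(x_1\cdots x_n)=\sum_{\pi\in \mathrm{Int}(n)}\prod_{V\in\pi}\beta_{|V|;\nu}((x_1,\ldots,x_n)\mid V)$. - c-free cumulants $\kappa^{(c)}_{n;(\mu,\nu)}$ of $(\mu,\nu)$: $\nu(x_1\cdots x_n)=\sum_{\pi\in NC(n)}\prod_{V\in\pi\text{ inner}}\kappa_{|V|;\mu}((x_1,\ldots,x_n)\mid V)\prod_{W\in\pi\text{ outer}}\kappa^{(c)}_{|W|;(\mu,\nu)}((x_1,\ldots,x_n)\mid W)$. - Infinitesimal free cumulants $\kappa'_{n;(\mu,\mu')}$ of $(\mu,\mu')$: $\mu'(x_1\cdots x_n)=\sum_{\pi\in NC(n)}\sum_{V_o\in\pi}\kappa'_{|V_o|;(\mu,\mu')}((x_1,\ldots,x_n)\mid V_o)\prod_{V\in\pi, V\ne V_o}\kappa_{|V|;\mu}((x_1,\ldots,x_n)\mid V)$.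 The map $\Psi_k:\mathcal{D}_{\mathrm{alg}}(k)\to\mathcal{D}'_{\mathrm{alg}}(k)$. For $\nu\in\mathcal{D}_{\mathrm{alg}}(k)$, $\Psi_k(\nu)=\mu'$ is the functional in $\mathcal{D}'_{\mathrm{alg}}(k)$ determined by $\mu'(X_{i_1}\cdots X_{i_n})=\sum_{m=1}^n\beta_{n+1;\nu}(X_{i_m},\ldots,X_{i_n},X_{i_1},\ldots,X_{i_m})$ for all $n\ge1$ and $i_1,\ldots,i_n\in\{1,\ldots,k\}$. Convolutions. $\mu_1\boxplus\mu_2\in\mathcal{D}_{\mathrm{alg}}(k)$ is the unique distribution $\mu$ with $\kappa_{n;\mu}(X_{i_1},\ldots,X_{i_n})=\kappa_{n;\mu_1}(X_{i_1},\ldots,X_{i_n})+\kappa_{n;\mu_2}(X_{i_1},\ldots,X_{i_n})$ for all $n$ and all $i_1,\ldots,i_n\in\{1,\ldots,k\}$. For $\mu_1,\mu_2,\nu_1,\nu_2\in\mathcal{D}_{\mathrm{alg}}(k)$, $(\mu_1,\nu_1)\boxplus_c(\mu_2,\nu_2):=(\mu,\nu)$ where $\mu=\mu_1\boxplus\mu_2$ and $\nu\in\mathcal{D}_{\mathrm{alg}}(k)$ is the unique distribution such that $\kappa^{(c)}_{n;(\mu,\nu)}(X_{i_1},\ldots,X_{i_n})=\kappa^{(c)}_{n;(\mu_1,\nu_1)}(X_{i_1},\ldots,X_{i_n})+\kappa^{(c)}_{n;(\mu_2,\nu_2)}(X_{i_1},\ldots,X_{i_n})$ for all $n$ and $i_1,\ldots,i_n$.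 For $\mu_1,\mu_2\in\mathcal{D}_{\mathrm{alg}}(k)$, $\mu_1',\mu_2'\in\mathcal{D}'_{\mathrm{alg}}(k)$, $(\mu_1,\mu_1')\boxplus_B(\mu_2,\mu_2'):=(\mu,\mu')$ where $\mu=\mu_1\boxplus\mu_2$ and $\mu'\in\mathcal{D}'_{\mathrm{alg}}(k)$ is the unique functional such that $\kappa'_{n;(\mu,\mu')}(X_{i_1},\ldots,X_{i_n})=\kappa'_{n;(\mu_1,\mu_1')}(X_{i_1},\ldots,X_{i_n})+\kappa'_{n;(\mu_2,\mu_2')}(X_{i_1},\ldots,X_{i_n})$ for all $n$ and $i_1,\ldots,i_n$. *)

(* Defs.v *)
From HB Require Import structures.
From mathcomp Require Import all_boot all_order all_algebra.
From mathcomp Require Import boolp reals complex monalg.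

Set Implicit Arguments.
Unset Strict Implicit.
Unset Printing Implicit Defensive.

Import GRing.Theory.
Local Open Scope ring_scope.

Section Partitions.
Variable n : nat.
Implicit Types (P : {set {set 'I_n}}) (V W : {set 'I_n}).

Definition noncrossing P : bool :=
  [forall V in P, forall W in P, forall a in V, forall b in W, forall c in V,
   forall d in W, [&& (a < b)%N, (b < c)%N & (c < d)%N] ==> (V == W)].

Definition NC : {set {set {set 'I_n}}} :=
  [set P | partition P [set: 'I_n] & noncrossing P].

Definition consecutive V : bool :=
  [forall i in V, forall j in V, forall l : 'I_n, (i <= l <= j)%N ==> (l \in V)].

Definition IntP : {set {set {set 'I_n}}} :=
  [set P in NC | [forall V in P, consecutive V]].

(* Minimum and maximum of a block; the default values are irrelevant because
   the blocks of a partition are nonempty. *)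
Definition bmin V : nat := \big[minn/n]_(i in V) (i : nat).
Definition bmax V : nat := (\max_(i in V) (i : nat))%N.

Definition inner P V : bool :=
  [exists W in P,
     [&& (bmin W < bmin V)%N, (bmin V <= bmax V)%N & (bmax V < bmax W)%N]].

Definition outer P V : bool := ~~ inner P V.

End Partitions.

(* (x_1, ..., x_n) | M, the subsequence of s at the positions in M. *)
Definition restr (T : Type) (s : seq T) (M : {set 'I_(size s)}) : seq T :=
  mask [seq i \in M | i <- enum 'I_(size s)] s.

(* A family of functionals (kappa_n : T^n -> C), n >= 1, is encoded as one
   function on sequences, kappa_n being its restriction to those of size n;
   its value on the empty sequence is never used. *)
Section Expansions.
Variables (C : comNzRingType) (T : Type).
Implicit Types (kappa : seq T -> C) (s : seq T).

Definition free_sum kappa s : C :=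
  \sum_(P in NC (size s)) \prod_(V in P) kappa (restr V).

Definition bool_sum kappa s : C :=
  \sum_(P in IntP (size s)) \prod_(V in P) kappa (restr V).

Definition cfree_sum kappa kappac s : C :=
  \sum_(P in NC (size s))
     (\prod_(V in P | inner P V) kappa (restr V)) *
     (\prod_(W in P | outer P W) kappac (restr W)).

Definition inf_sum kappa kappa' s : C :=
  \sum_(P in NC (size s)) \sum_(Vo in P)
     kappa' (restr Vo) * \prod_(V in P | V != Vo) kappa (restr V).

End Expansions.

Section PartitionLemmas.
Variable n : nat.
Implicit Types (P : {set {set 'I_n}}) (V : {set 'I_n}).

Lemma partition_one_block : (0 < n)%N -> partition [set [set: 'I_n]] [set: 'I_n].
Proof.
move=> n_gt0; rewrite /partition trivIset1 cover1 eqxx /= inE eq_sym.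
by rewrite -card_gt0 cardsT card_ord.
Qed.

Lemma one_block_NC : (0 < n)%N -> [set [set: 'I_n]] \in NC n.
Proof.
move=> n_gt0; rewrite inE partition_one_block //=.
apply/forall_inP => V; rewrite inE => /eqP->.
apply/forall_inP => W; rewrite inE => /eqP->.
by do 4![apply/forall_inP => ? _]; rewrite eqxx implybT.
Qed.

Lemma one_block_IntP : (0 < n)%N -> [set [set: 'I_n]] \in IntP n.
Proof.
move=> n_gt0; rewrite inE one_block_NC //=.
apply/forall_inP => V; rewrite inE => /eqP->.
by do 2![apply/forall_inP => ? _]; apply/forallP => l; rewrite inE implybT.
Qed.

Lemma one_block_outer : outer [set [set: 'I_n]] [set: 'I_n].
Proof.
apply/existsP => -[W]; rewrite inE => /andP[/eqP->].
by rewrite ltnn.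
Qed.

Lemma NC_block_proper P V :
  P \in NC n -> P != [set [set: 'I_n]] -> V \in P ->
  V != set0 /\ V != [set: 'I_n].
Proof.
rewrite inE => /andP[/and3P[_ /trivIsetP tiP nP0] _] PN VP.
have bl0 W : W \in P -> W != set0.
  by move=> WP; apply: contraNneq nP0 => <-.
split; first exact: bl0.
apply: contraNneq PN => VT; rewrite VT in VP.
apply/eqP/setP => W; rewrite inE; apply/idP/eqP => [WP|->//].
apply/eqP; apply: contraT => WT; have := tiP _ _ WP VP WT.
by rewrite -setI_eq0 setIT (negPf (bl0 _ WP)).
Qed.

End PartitionLemmas.

Lemma size_restr (T : Type) (s : seq T) (V : {set 'I_(size s)}) :
  size (restr V) = #|V|.
Proof.
rewrite size_mask; last by rewrite size_map size_enum_ord.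
rewrite count_map cardE -size_filter.
by rewrite enumT; congr size; apply: eq_filter.
Qed.

Lemma restrT (T : Type) (s : seq T) : restr [set: 'I_(size s)] = s.
Proof.
rewrite /restr (_ : map _ _ = nseq (size s) true) ?mask_true //.
rewrite -[in nseq _ _](size_enum_ord (size s)).
by elim: (enum _) => //= i e ->; rewrite inE.
Qed.

(* The moment-cumulant formulas are triangular: the one-block partition
   contributes kappa s, and the other terms only involve strict subsequences. *)
Section Triangular.
Variables (C : comNzRingType) (T : Type).
Implicit Types (kappa : seq T -> C) (s : seq T).

Definition triangular (E : (seq T -> C) -> seq T -> C) : Prop :=
  exists G : (seq T -> C) -> seq T -> C,
    (forall kappa s, (0 < size s)%N -> E kappa s = kappa s + G kappa s) /\
    (forall kappa kappa' s,
       (forall t, (0 < size t < size s)%N -> kappa t = kappa' t) ->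
       G kappa s = G kappa' s).

Variable E : (seq T -> C) -> seq T -> C.
Hypothesis E_tri : triangular E.

Lemma triangular_exists (m : seq T -> C) :
  exists kappa, forall s, (0 < size s)%N -> m s = E kappa s.
Proof.
have [G [EG Gext]] := E_tri.
pose K n := iter n (fun kappa s => m s - G kappa s) (fun=> 0).
have KE n p s : (size s < n)%N -> (size s < p)%N -> K n s = K p s.
  elim: n p s => [//|n IHn] [//|p] s; rewrite !ltnS => sn sp /=.
  congr (_ - _); apply: Gext => t /andP[_ ts].
  by apply: IHn; apply: leq_trans ts _.
exists (fun s => K (size s).+1 s) => s s_gt0.
rewrite EG // (Gext _ (K (size s))) ?subrK // => t /andP[_ ts].
by apply: KE; rewrite ?ltnSn.
Qed.

Lemma triangular_unique kappa kappa' :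
  (forall s, (0 < size s)%N -> E kappa s = E kappa' s) ->
  forall s, (0 < size s)%N -> kappa s = kappa' s.
Proof.
have [G [EG Gext]] := E_tri.
move=> EE s; have [n] := ubnP (size s).
elim: n s => // n IHn s; rewrite ltnS => sn s_gt0.
have := EE s s_gt0; rewrite !EG // (Gext kappa kappa'); first exact: addIr.
by move=> t /andP[t_gt0 ts]; apply: IHn => //; apply: leq_trans ts _.
Qed.

End Triangular.

Section ExpansionLemmas.
Variable (C : comNzRingType).

Lemma restr_lt (T : Type) (s : seq T) (P : {set {set 'I_(size s)}}) V :
  P \in NC (size s) -> P != [set setT] -> V \in P ->
  (0 < size (restr V) < size s)%N.
Proof.
move=> PNC P1 VP; have [V0 VT] := NC_block_proper PNC P1 VP.
rewrite size_restr card_gt0 V0 /= -[X in (_ < X)%N](card_ord (size s)) -cardsT.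
by apply: proper_card; rewrite properEneq VT subsetT.
Qed.

Lemma free_sum_triangular T : triangular (@free_sum C T).
Proof.
exists (fun kappa s => \sum_(P in NC (size s) | P != [set setT])
  \prod_(V in P) kappa (restr V)); split => [kappa s s_gt0|kappa kappa' s kk].
  by rewrite /free_sum (bigD1 [set setT]) ?one_block_NC //= big_set1 restrT.
by apply: eq_bigr => P /andP[PNC P1]; apply: eq_bigr => V VP;
  apply/kk/(restr_lt PNC).
Qed.

Lemma bool_sum_triangular T : triangular (@bool_sum C T).
Proof.
exists (fun kappa s => \sum_(P in IntP (size s) | P != [set setT])
  \prod_(V in P) kappa (restr V)); split => [kappa s s_gt0|kappa kappa' s kk].
  by rewrite /bool_sum (bigD1 [set setT]) ?one_block_IntP //= big_set1 restrT.
apply: eq_bigr => P /andP[]; rewrite inE => /andP[PNC _] P1.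
by apply: eq_bigr => V VP; apply/kk/(restr_lt PNC).
Qed.

Lemma cfree_sum_triangular T kappa : triangular (@cfree_sum C T kappa).
Proof.
exists (fun kappac s => \sum_(P in NC (size s) | P != [set setT])
  (\prod_(V in P | inner P V) kappa (restr V)) *
  (\prod_(W in P | outer P W) kappac (restr W)));
  split => [kappac s s_gt0|k1 k2 s kk].
  rewrite /cfree_sum (bigD1 [set setT]) ?one_block_NC //=; congr (_ + _).
  have out1 := one_block_outer (size s).
  rewrite big1 ?mul1r => [|V /andP[]]; last first.
    by rewrite inE => /eqP->; rewrite (negPf out1).
  rewrite (big_pred1 setT) ?restrT // => V; rewrite inE /=.
  by case: eqP => // ->; rewrite out1.
apply: eq_bigr => P /andP[PNC P1]; congr (_ * _).
by apply: eq_bigr => V /andP[VP _]; apply/kk/(restr_lt PNC).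
Qed.

Lemma inf_sum_triangular T kappa : triangular (@inf_sum C T kappa).
Proof.
exists (fun kappa' s => \sum_(P in NC (size s) | P != [set setT])
  \sum_(Vo in P)
     kappa' (restr Vo) * \prod_(V in P | V != Vo) kappa (restr V));
  split => [kappac s s_gt0|k1 k2 s kk].
  rewrite /inf_sum (bigD1 [set setT]) ?one_block_NC //= big_set1 restrT.
  congr (_ + _); rewrite big1 ?mulr1 // => V; rewrite inE => /andP[-> //].
apply: eq_bigr => P /andP[PNC P1]; apply: eq_bigr => V VP; congr (_ * _).
exact/kk/(restr_lt PNC).
Qed.

Variables (S T : Type) (f : S -> T) (w : seq S).

Lemma free_sum_map kappa :
  free_sum kappa (map f w) = free_sum (kappa \o map f) w :> C.
Proof.
rewrite /free_sum /restr size_map; apply: eq_bigr => P _; apply: eq_bigr => V _.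
by rewrite /= map_mask.
Qed.

Lemma cfree_sum_map kappa kappac :
  cfree_sum kappa kappac (map f w) =
  cfree_sum (kappa \o map f) (kappac \o map f) w :> C.
Proof.
rewrite /cfree_sum /restr size_map; apply: eq_bigr => P _.
by congr (_ * _); apply: eq_bigr => V _; rewrite /= map_mask.
Qed.

Lemma inf_sum_map kappa kappa' :
  inf_sum kappa kappa' (map f w) =
  inf_sum (kappa \o map f) (kappa' \o map f) w :> C.
Proof.
rewrite /inf_sum /restr size_map; apply: eq_bigr => P _; apply: eq_bigr => V _.
by rewrite /= map_mask; congr (_ * _); apply: eq_bigr => U _; rewrite /= map_mask.
Qed.

End ExpansionLemmas.

Section Multilinear.
Variables (C : comNzRingType) (U : lmodType C).
Implicit Types (kappa : seq U -> C) (s : seq U).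

Definition multilinear kappa : Prop :=
  forall (s1 s2 : seq U) (a : C) (x y : U),
    kappa (s1 ++ (a *: x + y) :: s2) =
    a * kappa (s1 ++ x :: s2) + kappa (s1 ++ y :: s2).

Lemma mask_split (b : bitseq) (s1 s2 : seq U) :
  size b = (size s1 + (size s2).+1)%N ->
  exists t1 t2, forall z,
    mask b (s1 ++ z :: s2) = t1 ++ nseq (nth false b (size s1)) z ++ t2.
Proof.
move=> sb; have s1b : (size s1 < size b)%N by rewrite sb -addSnnS leq_addr.
exists (mask (take (size s1) b) s1), (mask (drop (size s1).+1 b) s2) => z.
rewrite -{1}(cat_take_drop (size s1) b) (drop_nth false) //.
by rewrite mask_cat ?mask_cons // size_takel // ltnW.
Qed.

Lemma prod_restr_multilinear n (P : {set {set 'I_n}})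
    (K : {set 'I_n} -> seq U -> C) (s1 s2 : seq U) :
  partition P [set: 'I_n] -> n = (size s1 + (size s2).+1)%N ->
  (forall V, multilinear (K V)) ->
  let F z := \prod_(V in P)
    K V (mask [seq i \in V | i <- enum 'I_n] (s1 ++ z :: s2)) in
  forall (a : C) (x y : U), F (a *: x + y) = a * F x + F y.
Proof.
move=> partP nE Kml F a x y.
have lt_n : (size s1 < n)%N by rewrite nE -addSnnS leq_addr.
pose p := Ordinal lt_n; pose V0 := pblock P p.
have [/eqP covP tiP _] := and3P partP.
have V0P : V0 \in P by rewrite pblock_mem // covP.
have splitV (V : {set 'I_n}) : exists t1 t2, forall z,
    mask [seq i \in V | i <- enum 'I_n] (s1 ++ z :: s2) =
    t1 ++ nseq (p \in V) z ++ t2.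
  have sb : size [seq i \in V | i <- enum 'I_n] = (size s1 + (size s2).+1)%N.
    by rewrite size_map size_enum_ord.
  have [t1 [t2 tE]] := mask_split sb.
  exists t1, t2 => z; rewrite tE (nth_map p) ?size_enum_ord //.
  suff -> : nth p (enum 'I_n) (size s1) = p by [].
  by apply/val_inj; rewrite /= nth_enum_ord.
have FE z : F z = K V0 (mask [seq i \in V0 | i <- enum 'I_n] (s1 ++ z :: s2)) *
    \prod_(V in P | V != V0)
      K V (mask [seq i \in V | i <- enum 'I_n] (s1 ++ x :: s2)).
  rewrite /F (bigD1 V0) //=; congr (_ * _).
  apply: eq_bigr => V /andP[VP VV0]; have [t1 [t2 tE]] := splitV V.
  have pV : p \notin V.
    by apply: contra VV0 => pV; rewrite eq_sym /V0 (def_pblock tiP VP pV).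
  by rewrite !tE (negPf pV).
have [t1 [t2 tE]] := splitV V0.
by rewrite !FE !tE mem_pblock covP inE /= Kml mulrDl mulrA.
Qed.

Lemma free_sum_multilinear kappa :
  multilinear kappa -> multilinear (free_sum kappa).
Proof.
move=> kml s1 s2 a x y; rewrite /free_sum /restr !size_cat /= mulr_sumr -big_split.
apply: eq_bigr => P; rewrite inE => /andP[partP _].
exact: (@prod_restr_multilinear _ P (fun=> kappa) s1 s2 partP).
Qed.

Lemma bool_sum_multilinear kappa :
  multilinear kappa -> multilinear (bool_sum kappa).
Proof.
move=> kml s1 s2 a x y; rewrite /bool_sum /restr !size_cat /= mulr_sumr -big_split.
apply: eq_bigr => P; rewrite !inE => /andP[/andP[partP _] _].
exact: (@prod_restr_multilinear _ P (fun=> kappa) s1 s2 partP).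
Qed.

Lemma cfree_sum_multilinear kappa kappac :
  multilinear kappa -> multilinear kappac ->
  multilinear (cfree_sum kappa kappac).
Proof.
move=> kml kcml s1 s2 a x y.
rewrite /cfree_sum /restr !size_cat /= mulr_sumr -big_split.
apply: eq_bigr => P; rewrite inE => /andP[partP _].
pose K V := if inner P V then kappa else kappac.
have Kml V : multilinear (K V) by rewrite /K; case: ifP.
pose M z (V : {set 'I_(size s1 + (size s2).+1)}) := mask [seq i \in V | i <- enum 'I_(size s1 + (size s2).+1)]
  (s1 ++ z :: s2).
have KE z : \prod_(V in P) K V (M z V) =
    (\prod_(V in P | inner P V) kappa (M z V)) *
    (\prod_(V in P | outer P V) kappac (M z V)).
  rewrite (bigID (fun V => inner P V)) /=; congr (_ * _);
    apply: eq_bigr => V /andP[_]; rewrite /K; first by move->.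
  by move/negPf->.
by have := @prod_restr_multilinear _ P K s1 s2 partP erefl Kml a x y;
  rewrite /= -/(M x) -/(M y) -/(M (a *: x + y)) !KE.
Qed.

Lemma inf_sum_multilinear kappa kappa' :
  multilinear kappa -> multilinear kappa' ->
  multilinear (inf_sum kappa kappa').
Proof.
move=> kml kml' s1 s2 a x y.
rewrite /inf_sum /restr !size_cat /= mulr_sumr -big_split.
apply: eq_bigr => P; rewrite inE => /andP[partP _].
rewrite mulr_sumr -big_split; apply: eq_bigr => Vo VoP.
pose K V := if V == Vo then kappa' else kappa.
have Kml V : multilinear (K V) by rewrite /K; case: ifP.
have := @prod_restr_multilinear _ P K s1 s2 partP erefl Kml a x y => /=.
have KE z : \prod_(V in P) K V (mask
      [seq i \in V | i <- enum 'I_(size s1 + (size s2).+1)] (s1 ++ z :: s2)) =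
    kappa' (mask [seq i \in Vo | i <- enum 'I_(size s1 + (size s2).+1)]
      (s1 ++ z :: s2)) *
    \prod_(V in P | V != Vo) kappa (mask
      [seq i \in V | i <- enum 'I_(size s1 + (size s2).+1)] (s1 ++ z :: s2)).
  rewrite (bigD1 Vo) //= {1}/K eqxx; congr (_ * _).
  by apply: eq_bigr => V /andP[_ /negPf VVo]; rewrite /K VVo.
by rewrite !KE.
Qed.

Lemma triangular_multilinear E (m kappa : seq U -> C) :
  triangular E ->
  (forall kappa0, multilinear kappa0 -> multilinear (E kappa0)) ->
  multilinear m -> (forall s, (0 < size s)%N -> m s = E kappa s) ->
  multilinear kappa.
Proof.
move=> [G [EG Gext]] Eml mml mE s1 s2; have [n] := ubnP (size s1 + size s2).
elim: n s1 s2 => // n IHn s1 s2; rewrite ltnS => sn a x y.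
pose k0 t := if (size t < size s1 + (size s2).+1)%N then kappa t else 0.
have k0ml : multilinear k0.
  move=> t1 t2 b z u; rewrite /k0 !size_cat /=; case: ifP => [|_].
    by rewrite !addnS ltnS => ts; apply: IHn; apply: leq_trans ts sn.
  by rewrite mulr0 addr0.
have kE z : kappa (s1 ++ z :: s2) = m (s1 ++ z :: s2) - E k0 (s1 ++ z :: s2).
  have s0 : (0 < size (s1 ++ z :: s2))%N by rewrite size_cat /= addnS.
  rewrite mE // !EG // {1}/k0 size_cat /= ltnn add0r.
  rewrite (Gext k0 kappa) ?addrK // => t /andP[_].
  by rewrite size_cat /k0 /= => ->.
by rewrite !kE mml (Eml _ k0ml) mulrBr addrACA opprD.
Qed.

End Multilinear.

(* Non-commutative polynomials: the algebra of the free monoid on k letters. *)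
Definition ncpoly (C : comNzRingType) (k : nat) := {malg C[{fmonom 'I_k}]}.

Definition ncX (C : comNzRingType) (k : nat) (i : 'I_k) : ncpoly C k :=
  << fmu i >>.

Record Dalg (C : comNzRingType) (k : nat) := MkDalg {
  dalg_form :> {scalar ncpoly C k};
  dalg1 : dalg_form 1 = 1 }.

Record Dalg' (C : comNzRingType) (k : nat) := MkDalg' {
  dalg'_form :> {scalar ncpoly C k};
  dalg'1 : dalg'_form 1 = 0 }.

Definition tracial (C : comNzRingType) (k : nat) (mu : Dalg C k) : Prop :=
  forall P Q : ncpoly C k, mu (P * Q) = mu (Q * P).

Section Distributions.
Variables (C : comNzRingType) (k : nat).
Local Notation A := (ncpoly C k).
Local Notation word w := (\prod_(i <- w) ncX C i).

Lemma scalar_ext (f g : {scalar A}) : f =1 g -> f = g.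
Proof.
case: f g => f [[fa] [fs]] [g [[ga] [gs]]] /= /funext fg.
rewrite fg in fa fs *.
by rewrite (Prop_irrelevance fa ga) (Prop_irrelevance fs gs).
Qed.

Lemma wordE (w : seq 'I_k) : word w = << FMonom w >> :> A.
Proof.
elim: w => [|i w IHw]; first by rewrite big_nil -fmoneE.
rewrite big_cons IHw [LHS]fgmulUU mulr1; congr << _ >>.
by rewrite /mmul /= fmuE fmmulE.
Qed.

Lemma word_ext (f g : {scalar A}) : (forall w, f (word w) = g (word w)) -> f = g.
Proof.
move=> fg; apply: scalar_ext => p; rewrite (monalgE p) !linear_sum.
apply: eq_bigr => m _; have := fg m; rewrite wordE fmK => fgm.
rewrite (_ : << p@_m *g m >> = p@_m *: << m >>); first by rewrite !linearZ /= fgm.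
by apply/malgP => l; rewrite mcoeffZ !mcoeffU mulrnAr mulr1.
Qed.

Lemma word_lift (h : seq 'I_k -> C) : exists f : {scalar A},
  forall w, f (word w) = h w.
Proof.
pose f : A -> C := mmap idfun (fun m : {fmonom 'I_k} => h m).
have fZ : scalable_for *%R f.
  move=> c p; rewrite /f (mmapEw (f := idfun) (msuppZ_le _ _)) mmapE big_distrr /=.
  by apply: eq_bigr => m _; rewrite mcoeffZ mulrA.
have fD : zmod_morphism f by apply: raddfB.
pose fa := GRing.isZmodMorphism.Build A C f fD.
pose fs := GRing.isScalable.Build C A C *%R f fZ.
pose F : {scalar A} := HB.pack f fa fs.
exists F => w; rewrite wordE.
by have := mmapU (f := idfun) (h := fun m : {fmonom 'I_k} => h m) 1 (FMonom w);
  rewrite mul1r.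
Qed.

Lemma Dalg_ext (mu nu : Dalg C k) :
  (forall w : seq 'I_k, (0 < size w)%N -> mu (word w) = nu (word w)) -> mu = nu.
Proof.
case: mu nu => [mu mu1] [nu nu1] /= mn.
have {}mn : mu = nu.
  apply: word_ext => -[|i w]; first by rewrite big_nil mu1 nu1.
  exact: mn.
by rewrite {}mn in mu1 *; rewrite (Prop_irrelevance mu1 nu1).
Qed.

Lemma Dalg'_ext (mu nu : Dalg' C k) :
  (forall w : seq 'I_k, (0 < size w)%N -> mu (word w) = nu (word w)) -> mu = nu.
Proof.
case: mu nu => [mu mu1] [nu nu1] /= mn.
have {}mn : mu = nu.
  apply: word_ext => -[|i w]; first by rewrite big_nil mu1 nu1.
  exact: mn.
by rewrite {}mn in mu1 *; rewrite (Prop_irrelevance mu1 nu1).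
Qed.

Lemma Dalg_lift (h : seq 'I_k -> C) : exists mu : Dalg C k,
  forall w : seq 'I_k, (0 < size w)%N -> mu (word w) = h w.
Proof.
have [f fE] := word_lift (fun w => if w is [::] then 1 else h w).
have f1 : f 1 = 1 by have := fE [::]; rewrite big_nil.
by exists (MkDalg f1) => -[//|i w] _ /=; rewrite fE.
Qed.

Lemma Dalg'_lift (h : seq 'I_k -> C) : exists mu : Dalg' C k,
  forall w : seq 'I_k, (0 < size w)%N -> mu (word w) = h w.
Proof.
have [f fE] := word_lift (fun w => if w is [::] then 0 else h w).
have f1 : f 1 = 0 by have := fE [::]; rewrite big_nil.
by exists (MkDalg' f1) => -[//|i w] _ /=; rewrite fE.
Qed.

End Distributions.

(* Each family or functional that is characterised by a system of identities is
   introduced by a predicate is_..., with proofs of existence (used to define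
   the object) and of uniqueness. *)
Section Cumulants.
Variables (C : comNzRingType) (k : nat).
Local Notation A := (ncpoly C k).
Implicit Types (mu nu : Dalg C k) (s : seq A).

Lemma ncscalerAr (a : C) (p q : A) : p * (a *: q) = a *: (p * q).
Proof.
rewrite (malgMEw (finmap.fsubset_refl _) (msuppZ_le a q)) malgME scaler_sumr.
apply: eq_bigr => m _; rewrite scaler_sumr; apply: eq_bigr => l _.
by apply/malgP => j; rewrite !mcoeffsE mulrnAr mulrCA.
Qed.

Lemma moment_multilinear (f : {scalar A}) :
  multilinear (fun s => f (\prod_(x <- s) x)).
Proof.
move=> s1 s2 a x y; rewrite !big_cat !big_cons /= mulrDl mulrDr linearD /=.
by congr (_ + _); rewrite -linearZ /=; congr (f _); rewrite -scalerAl ncscalerAr.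
Qed.

Definition is_free_cumulants mu (kappa : seq A -> C) : Prop :=
  multilinear kappa /\
  forall s, (0 < size s)%N ->
    mu (\prod_(x <- s) x) = free_sum kappa s.

Lemma free_cumulants_exist mu : exists kappa, is_free_cumulants mu kappa.
Proof.
have tri := free_sum_triangular C A.
have [kappa kE] := triangular_exists tri (fun s => mu (\prod_(x <- s) x)).
exists kappa; split => //.
apply: (triangular_multilinear tri _ (moment_multilinear mu) kE) => ?.
exact: free_sum_multilinear.
Qed.

Definition free_cumulant mu : seq A -> C := sval (cid (free_cumulants_exist mu)).

Lemma free_cumulantP mu : is_free_cumulants mu (free_cumulant mu).
Proof. exact: svalP (cid (free_cumulants_exist mu)). Qed.

Lemma free_cumulants_unique mu kappa : is_free_cumulants mu kappa ->
  forall s, (0 < size s)%N -> kappa s = free_cumulant mu s.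
Proof.
case=> _ H; apply: (triangular_unique (free_sum_triangular C A)) => s s0.
by rewrite -H // -(free_cumulantP mu).2.
Qed.

Definition is_bool_cumulants nu (beta : seq A -> C) : Prop :=
  multilinear beta /\
  forall s, (0 < size s)%N ->
    nu (\prod_(x <- s) x) = bool_sum beta s.

Lemma bool_cumulants_exist nu : exists beta, is_bool_cumulants nu beta.
Proof.
have tri := bool_sum_triangular C A.
have [kappa kE] := triangular_exists tri (fun s => nu (\prod_(x <- s) x)).
exists kappa; split => //.
apply: (triangular_multilinear tri _ (moment_multilinear nu) kE) => ?.
exact: bool_sum_multilinear.
Qed.

Definition bool_cumulant nu : seq A -> C := sval (cid (bool_cumulants_exist nu)).

Lemma bool_cumulantP nu : is_bool_cumulants nu (bool_cumulant nu).
Proof. exact: svalP (cid (bool_cumulants_exist nu)). Qed.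

Lemma bool_cumulants_unique nu beta : is_bool_cumulants nu beta ->
  forall s, (0 < size s)%N -> beta s = bool_cumulant nu s.
Proof.
case=> _ H; apply: (triangular_unique (bool_sum_triangular C A)) => s s0.
by rewrite -H // -(bool_cumulantP nu).2.
Qed.

Definition is_cfree_cumulants mu nu (kappac : seq A -> C) : Prop :=
  multilinear kappac /\
  forall s, (0 < size s)%N ->
    nu (\prod_(x <- s) x) = cfree_sum (free_cumulant mu) kappac s.

Lemma cfree_cumulants_exist mu nu : exists kappac, is_cfree_cumulants mu nu kappac.
Proof.
have tri := cfree_sum_triangular (free_cumulant mu).
have [kappa kE] := triangular_exists tri (fun s => nu (\prod_(x <- s) x)).
exists kappa; split => //.
apply: (triangular_multilinear tri _ (moment_multilinear nu) kE) => ?.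
exact/cfree_sum_multilinear/(free_cumulantP mu).1.
Qed.

Definition cfree_cumulant mu nu : seq A -> C :=
  sval (cid (cfree_cumulants_exist mu nu)).

Lemma cfree_cumulantP mu nu : is_cfree_cumulants mu nu (cfree_cumulant mu nu).
Proof. exact: svalP (cid (cfree_cumulants_exist mu nu)). Qed.

Lemma cfree_cumulants_unique mu nu kappac : is_cfree_cumulants mu nu kappac ->
  forall s, (0 < size s)%N -> kappac s = cfree_cumulant mu nu s.
Proof.
case=> _ H; apply: (triangular_unique (cfree_sum_triangular (free_cumulant mu))).
by move=> s s0; rewrite -H // -(cfree_cumulantP mu nu).2.
Qed.

Definition is_inf_cumulants mu (mu' : Dalg' C k) (kappa' : seq A -> C) : Prop :=
  multilinear kappa' /\
  forall s, (0 < size s)%N ->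
    mu' (\prod_(x <- s) x) = inf_sum (free_cumulant mu) kappa' s.

Lemma inf_cumulants_exist mu (mu' : Dalg' C k) : exists kappa', is_inf_cumulants mu mu' kappa'.
Proof.
have tri := inf_sum_triangular (free_cumulant mu).
have [kappa kE] := triangular_exists tri (fun s => mu' (\prod_(x <- s) x)).
exists kappa; split => //.
apply: (triangular_multilinear tri _ (moment_multilinear mu') kE) => ?.
exact/inf_sum_multilinear/(free_cumulantP mu).1.
Qed.

Definition inf_cumulant mu (mu' : Dalg' C k) : seq A -> C :=
  sval (cid (inf_cumulants_exist mu mu')).

Lemma inf_cumulantP mu (mu' : Dalg' C k) : is_inf_cumulants mu mu' (inf_cumulant mu mu').
Proof. exact: svalP (cid (inf_cumulants_exist mu mu')). Qed.

Lemma inf_cumulants_unique mu (mu' : Dalg' C k) kappa' : is_inf_cumulants mu mu' kappa' ->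
  forall s, (0 < size s)%N -> kappa' s = inf_cumulant mu mu' s.
Proof.
case=> _ H; apply: (triangular_unique (inf_sum_triangular (free_cumulant mu))).
by move=> s s0; rewrite -H // -(inf_cumulantP mu mu').2.
Qed.

End Cumulants.

Section Psi.
Variables (C : comNzRingType) (k : nat).
Local Notation X := (@ncX C k).
Implicit Types (nu : Dalg C k) (w : seq 'I_k).

(* With m counted from 0, the cyclic argument (X_{i_m}, ..., X_{i_n}, X_{i_1},
   ..., X_{i_m}) is the tail of the word from position m followed by its first
   m + 1 letters. *)
Definition is_Psi nu (mu' : Dalg' C k) : Prop :=
  forall w, (0 < size w)%N ->
    mu' (\prod_(i <- w) X i) =
    \sum_(m < size w)
       bool_cumulant nu ([seq X i | i <- drop m w] ++ [seq X i | i <- take m.+1 w]).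

Lemma Psi_exists nu : exists mu' : Dalg' C k, is_Psi nu mu'.
Proof. exact: Dalg'_lift. Qed.

Definition Psi nu : Dalg' C k := sval (cid (Psi_exists nu)).

Lemma PsiP nu : is_Psi nu (Psi nu).
Proof. exact: svalP (cid (Psi_exists nu)). Qed.

Lemma Psi_unique nu (mu' : Dalg' C k) : is_Psi nu mu' -> mu' = Psi nu.
Proof. by move=> H; apply: Dalg'_ext => w w0; rewrite H // PsiP. Qed.

End Psi.

Section Convolutions.
Variables (C : comNzRingType) (k : nat).
Local Notation X := (@ncX C k).
Implicit Types (mu nu : Dalg C k) (w : seq 'I_k).

Lemma prod_map_X w : \prod_(x <- map X w) x = \prod_(i <- w) X i.
Proof. by rewrite big_map. Qed.

Definition is_boxplus mu1 mu2 mu : Prop :=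
  forall w, (0 < size w)%N ->
    free_cumulant mu (map X w) =
    free_cumulant mu1 (map X w) + free_cumulant mu2 (map X w).

Lemma boxplus_exists mu1 mu2 : exists mu, is_boxplus mu1 mu2 mu.
Proof.
pose K w := free_cumulant mu1 (map X w) + free_cumulant mu2 (map X w).
have [mu muE] := Dalg_lift (free_sum K).
exists mu; apply: (triangular_unique (free_sum_triangular C 'I_k)
  (kappa := free_cumulant mu \o map X) (kappa' := K)) => w w0.
by rewrite -free_sum_map -(free_cumulantP _).2 ?size_map // prod_map_X muE.
Qed.

Definition boxplus mu1 mu2 : Dalg C k := sval (cid (boxplus_exists mu1 mu2)).

Lemma boxplusP mu1 mu2 : is_boxplus mu1 mu2 (boxplus mu1 mu2).
Proof. exact: svalP (cid (boxplus_exists mu1 mu2)). Qed.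

Lemma free_sum_eq (T : Type) (kappa kappa' : seq T -> C) s : (0 < size s)%N ->
  (forall t, (0 < size t)%N -> kappa t = kappa' t) ->
  free_sum kappa s = free_sum kappa' s.
Proof.
have [G [EG Gext]] := free_sum_triangular C T.
move=> s0 kk; rewrite !EG // kk //; congr (_ + _); apply: Gext => t /andP[t0 _].
exact: kk.
Qed.

Lemma boxplus_unique mu1 mu2 mu : is_boxplus mu1 mu2 mu -> mu = boxplus mu1 mu2.
Proof.
move=> H; apply: Dalg_ext => w w0.
rewrite -prod_map_X !(free_cumulantP _).2 ?size_map // !free_sum_map.
by apply: free_sum_eq => // v v0 /=; rewrite H // boxplusP.
Qed.

Definition is_boxplus_c mu1 nu1 mu2 nu2 nu : Prop :=
  forall w, (0 < size w)%N ->
    cfree_cumulant (boxplus mu1 mu2) nu (map X w) =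
    cfree_cumulant mu1 nu1 (map X w) + cfree_cumulant mu2 nu2 (map X w).

Lemma boxplus_c_exists mu1 nu1 mu2 nu2 : exists nu, is_boxplus_c mu1 nu1 mu2 nu2 nu.
Proof.
pose K w := cfree_cumulant mu1 nu1 (map X w) + cfree_cumulant mu2 nu2 (map X w).
pose F := free_cumulant (boxplus mu1 mu2) \o map X.
have [nu nuE] := Dalg_lift (cfree_sum F K).
exists nu; apply: (triangular_unique (cfree_sum_triangular F)
  (kappa := cfree_cumulant (boxplus mu1 mu2) nu \o map X) (kappa' := K)) => w w0.
by rewrite -cfree_sum_map -(cfree_cumulantP _ _).2 ?size_map // prod_map_X nuE.
Qed.

Definition boxplus_c (p1 p2 : Dalg C k * Dalg C k) : Dalg C k * Dalg C k :=
  (boxplus p1.1 p2.1, sval (cid (boxplus_c_exists p1.1 p1.2 p2.1 p2.2))).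

Lemma boxplus_cP p1 p2 : is_boxplus_c p1.1 p1.2 p2.1 p2.2 (boxplus_c p1 p2).2.
Proof. exact: svalP (cid (boxplus_c_exists p1.1 p1.2 p2.1 p2.2)). Qed.

Lemma boxplus_c_unique p1 p2 nu :
  is_boxplus_c p1.1 p1.2 p2.1 p2.2 nu -> nu = (boxplus_c p1 p2).2.
Proof.
move=> H; apply: Dalg_ext => w w0; pose F := free_cumulant (boxplus p1.1 p2.1).
rewrite -prod_map_X !(cfree_cumulantP (boxplus p1.1 p2.1) _).2 ?size_map //.
rewrite !cfree_sum_map; have [G [EG Gext]] := cfree_sum_triangular (F \o map X).
have HH v : (0 < size v)%N ->
    (cfree_cumulant (boxplus p1.1 p2.1) nu \o map X) v =
    (cfree_cumulant (boxplus p1.1 p2.1) (boxplus_c p1 p2).2 \o map X) v.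
  by move=> v0 /=; rewrite H // (boxplus_cP p1 p2).
rewrite !EG // HH //; congr (_ + _); apply: Gext => v /andP[v0 _].
exact: HH.
Qed.

Definition is_boxplus_B mu1 (mu1' : Dalg' C k) mu2 (mu2' mu' : Dalg' C k) : Prop :=
  forall w, (0 < size w)%N ->
    inf_cumulant (boxplus mu1 mu2) mu' (map X w) =
    inf_cumulant mu1 mu1' (map X w) + inf_cumulant mu2 mu2' (map X w).

Lemma boxplus_B_exists mu1 (mu1' : Dalg' C k) mu2 (mu2' : Dalg' C k) :
  exists mu' : Dalg' C k, is_boxplus_B mu1 mu1' mu2 mu2' mu'.
Proof.
pose K w := inf_cumulant mu1 mu1' (map X w) + inf_cumulant mu2 mu2' (map X w).
pose F := free_cumulant (boxplus mu1 mu2) \o map X.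
have [mu' muE] := Dalg'_lift (inf_sum F K).
exists mu'; apply: (triangular_unique (inf_sum_triangular F)
  (kappa := inf_cumulant (boxplus mu1 mu2) mu' \o map X) (kappa' := K)) => w w0.
by rewrite -inf_sum_map -(inf_cumulantP _ _).2 ?size_map // prod_map_X muE.
Qed.

Definition boxplus_B (p1 p2 : Dalg C k * Dalg' C k) : Dalg C k * Dalg' C k :=
  (boxplus p1.1 p2.1, sval (cid (boxplus_B_exists p1.1 p1.2 p2.1 p2.2))).

Lemma boxplus_BP p1 p2 : is_boxplus_B p1.1 p1.2 p2.1 p2.2 (boxplus_B p1 p2).2.
Proof. exact: svalP (cid (boxplus_B_exists p1.1 p1.2 p2.1 p2.2)). Qed.

Lemma boxplus_B_unique p1 p2 (mu' : Dalg' C k) :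
  is_boxplus_B p1.1 p1.2 p2.1 p2.2 mu' -> mu' = (boxplus_B p1 p2).2.
Proof.
move=> H; apply: Dalg'_ext => w w0; pose F := free_cumulant (boxplus p1.1 p2.1).
rewrite -prod_map_X !(inf_cumulantP (boxplus p1.1 p2.1) _).2 ?size_map //.
rewrite !inf_sum_map; have [G [EG Gext]] := inf_sum_triangular (F \o map X).
have HH v : (0 < size v)%N ->
    (inf_cumulant (boxplus p1.1 p2.1) mu' \o map X) v =
    (inf_cumulant (boxplus p1.1 p2.1) (boxplus_B p1 p2).2 \o map X) v.
  by move=> v0 /=; rewrite H // (boxplus_BP p1 p2).
rewrite !EG // HH //; congr (_ + _); apply: Gext => v /andP[v0 _].
exact: HH.
Qed.

End Convolutions.

(* Main.v *)
(* All the expansions are organised by one block V of the partition: once V is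
   fixed, the other blocks form independent non-crossing partitions of the gaps
   of V, so that a sum over partitions becomes a sum over V of a product of
   moments of gaps. Write M for the moments of mu and c for the c-free cumulants.
   - For V the outer block of the first letter, this gives the Boolean cumulant
       beta(x, u, y) = sum over V in u of c(x, V, y) * prod M(gaps of V in u).
   - For the infinitesimal expansion, V is the marked block, and the letters
     before and after V form one gap, with moment M(before ++ after).
   In the value of Psi nu at a word w, the m-th term sees w cyclically, cut at
   its m-th letter; traciality of mu makes the gap across the cut independent of
   m. Comparing the two formulas,
       kappa'_n(x_1,...,x_n) = sum_m c_(n+1)(x_m,...,x_n,x_1,...,x_m)
   for (mu, Psi nu), which is linear in c. Traciality of mu1 [+] mu2 holds because
   moments are cyclic exactly when free cumulants are. *)
Require Import Defs.
From mathcomp Require Import all_boot all_order all_algebra.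
From mathcomp Require Import reals complex.
From mathcomp Require Import monalg ring.

Set Implicit Arguments.
Unset Strict Implicit.
Unset Printing Implicit Defensive.

Import GRing.Theory.
Local Open Scope ring_scope.

(** * Sums over splittings and over subwords *)

Section SplitSum.
Variables (C : comNzRingType) (T : Type).
Implicit Types (f g : seq T -> T -> seq T -> C) (a b s : seq T).

(** Started with an empty accumulator, this runs over all factorisations [a ++ y :: b] of the word.
    Keeping both sides as words lets nested sums be rearranged by induction, without index
    arithmetic. *)
Fixpoint split_sum_from f a s : C :=
  if s is y :: b then f a y b + split_sum_from f (rcons a y) b else 0.

Definition split_sum f s := split_sum_from f [::] s.

Lemma split_sum_from_cat f a0 a s :
  split_sum_from f (a0 ++ a) s = split_sum_from (fun a => f (a0 ++ a)) a s.
Proof. by elim: s a => //= y b IHb a; rewrite -IHb rcons_cat. Qed.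

Lemma split_sum_cons f y b :
  split_sum f (y :: b) = f [::] y b + split_sum (fun a => f (y :: a)) b.
Proof. by rewrite /split_sum /= -[[:: y]]cats0 split_sum_from_cat. Qed.

Lemma eq_split_sum f g s : (forall a y b, s = a ++ y :: b -> f a y b = g a y b) ->
  split_sum f s = split_sum g s.
Proof.
elim: s f g => // y b IHb f g fg; rewrite !split_sum_cons fg //; congr (_ + _).
by apply: IHb => a z c bE; apply: fg; rewrite bE.
Qed.

Lemma split_sumD f g s :
  split_sum (fun a y b => f a y b + g a y b) s = split_sum f s + split_sum g s.
Proof.
elim: s f g => [|y b IHb] f g; first by rewrite addr0.
by rewrite !split_sum_cons IHb addrACA.
Qed.

Lemma split_sumZ f (c : C) s :
  split_sum (fun a y b => c * f a y b) s = c * split_sum f s.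
Proof.
elim: s f => [|y b IHb] f; first by rewrite mulr0.
by rewrite !split_sum_cons IHb mulrDr.
Qed.

Lemma split_sum_rcons f s z :
  split_sum f (rcons s z) = split_sum (fun a y b => f a y (rcons b z)) s + f s z [::].
Proof.
elim: s f => [|y b IHb] f; first by rewrite /split_sum /= addrC.
by rewrite rcons_cons !split_sum_cons IHb addrA.
Qed.

(** Both sides run over the factorisations [a1 ++ z :: a2 ++ y :: b]; only the order in which [z]
    and [y] are chosen differs. *)
Lemma split_sum_exchange (f : seq T -> T -> seq T -> T -> seq T -> C) s :
  split_sum (fun a y b => split_sum (fun a1 z a2 => f a1 z a2 y b) a) s =
  split_sum (fun a1 z r => split_sum (fun a2 y b => f a1 z a2 y b) r) s.
Proof.
elim: s f => // x s IHs f; rewrite !split_sum_cons -IHs add0r -split_sumD.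
by apply: eq_split_sum => a y b _; rewrite split_sum_cons.
Qed.

Lemma split_sumE f s : split_sum f s =
  \sum_(i < size s) f (take i s) (tnth (in_tuple s) i) (drop i.+1 s).
Proof.
elim: s f => [|y b IHb] f; first by rewrite big_ord0.
rewrite split_sum_cons big_ord_recl /= drop0 IHb; congr (_ + _).
by apply: eq_bigr => i _; rewrite !(tnth_nth y).
Qed.

End SplitSum.

Section GapSum.
Variables (C : comNzRingType) (T : Type).
Implicit Types (M fin h k : seq T -> C) (a b s t u v : seq T).

(* The sum, over the subwords t of s (one for each set of positions), of h t
   times the product of the weights of the gaps left by t in s: fin for the last
   gap, M for the others. The accumulator u is the already read part of the
   first gap. *)
Fixpoint gapsum M fin u h s : C :=
  if s is x :: s' then
    M u * gapsum M fin [::] (fun t => h (x :: t)) s' + gapsum M fin (rcons u x) h s'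
  else h [::] * fin u.

Lemma eq_gapsum M M' fin fin' h h' u s :
  M =1 M' -> fin =1 fin' -> h =1 h' -> gapsum M fin u h s = gapsum M' fin' u h' s.
Proof.
move=> MM ff; elim: s u h h' => [|x s IHs] u h h' hh /=; first by rewrite hh ff.
by rewrite MM (IHs _ _ (fun t => h' (x :: t))) ?(IHs _ _ h') // => t; apply: hh.
Qed.

Lemma gapsumD M fin h k u s :
  gapsum M fin u (fun t => h t + k t) s = gapsum M fin u h s + gapsum M fin u k s.
Proof.
elim: s u h k => [|x s IHs] u h k /=; first by rewrite mulrDl.
by rewrite !IHs mulrDr addrACA.
Qed.

Lemma gapsumZ M fin h c u s :
  gapsum M fin u (fun t => c * h t) s = c * gapsum M fin u h s.
Proof.
elim: s u h => [|x s IHs] u h /=; first by rewrite mulrA.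
by rewrite !IHs mulrDr mulrCA.
Qed.

Lemma gapsum_exchange M fin M' fin' (h : seq T -> seq T -> C) u u' s s' :
  gapsum M fin u (fun t => gapsum M' fin' u' (h t) s') s =
  gapsum M' fin' u' (fun t' => gapsum M fin u (h^~ t') s) s'.
Proof.
elim: s u h => [|x s IHs] u h /=.
  by rewrite mulrC -gapsumZ; apply: eq_gapsum => // t; rewrite mulrC.
have /= -> := IHs [::] (fun t => h (x :: t)).
by rewrite IHs -gapsumZ -gapsumD.
Qed.

Lemma gapsum0 M fin h u s : (forall t, (size t <= size s)%N -> h t = 0) ->
  gapsum M fin u h s = 0.
Proof.
elim: s u h => [|x s IHs] u h h0 /=; first by rewrite h0 ?mul0r.
rewrite !IHs ?mulr0 ?addr0 // => t st; apply: h0 => //.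
exact: leq_trans st (leqnSn _).
Qed.

Lemma gapsum_full M fin h s : M [::] = 1 -> fin [::] = 1 ->
  (forall t, (size t < size s)%N -> h t = 0) -> gapsum M fin [::] h s = h s.
Proof.
move=> M1 f1; elim: s h => [|x s IHs] h h0 /=; first by rewrite f1 mulr1.
by rewrite M1 mul1r IHs ?gapsum0 ?addr0 // => t st; apply: h0.
Qed.

Lemma gapsum_first M fin h u s : gapsum M fin u h s = h [::] * fin (u ++ s) +
  split_sum (fun a y b => M (u ++ a) * gapsum M fin [::] (fun t => h (y :: t)) b) s.
Proof.
elim: s u => [|x s IHs] u /=; first by rewrite cats0 addr0.
rewrite split_sum_cons IHs cats0 addrCA cat_rcons; do 2!congr (_ + _).
by apply: eq_split_sum => a y b _; rewrite cat_rcons.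
Qed.

Lemma gapsum_last M fin h u s : gapsum M fin u h s = h [::] * fin (u ++ s) +
  split_sum (fun a y b => gapsum M M u (fun t => h (rcons t y)) a * fin b) s.
Proof.
elim: s u h => [|x s IHs] u h /=; first by rewrite cats0 addr0.
rewrite split_sum_cons /= (IHs [::]) (IHs (rcons u x)) /= cat_rcons.
set S1 := split_sum _ s; set S2 := split_sum _ s; set S3 := split_sum _ s.
have -> : S3 = M u * S1 + S2; last by ring.
rewrite -split_sumZ -split_sumD.
by apply: eq_split_sum => a y b _; rewrite mulrDl mulrA.
Qed.

(** Either the subword avoids [a], which then joins the last gap of [b], or [y] is its first letter
    in [a], and [a1] joins the gap that straddles the two words. *)
Lemma gapsum_cat M fin h u b a : gapsum M fin u h (b ++ a) =
  gapsum M (fun v => fin (v ++ a)) u h b +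
  split_sum (fun a1 y a2 => gapsum M (fun v => M (v ++ a1)) u
    (fun t1 => gapsum M fin [::] (fun t2 => h (t1 ++ y :: t2)) a2) b) a.
Proof.
elim: b u h => [|x b IHb] u h /=.
  by rewrite gapsum_first; congr (_ + _); apply: eq_split_sum => ? ? ? _; rewrite mulrC.
by rewrite !IHb mulrDr addrACA -split_sumZ -split_sumD.
Qed.

(** A subword with one distinguished letter can be chosen letter first: [y] cuts [s] into two words,
    in which the rest is chosen independently. *)
Lemma gapsum_split M fin (H : seq T -> T -> seq T -> C) u s :
  gapsum M fin u (split_sum H) s =
  split_sum (fun a y b => gapsum M M u
    (fun t1 => gapsum M fin [::] (fun t2 => H t1 y t2) b) a) s.
Proof.
elim: s u H => [|x s IHs] u H /=; first by rewrite mul0r.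
rewrite split_sum_cons /= IHs.
rewrite (eq_gapsum (M' := M) (fin' := fin)
  (h' := fun t => H [::] x t + split_sum (fun a => H (x :: a)) t)) //; last first.
  by move=> t; rewrite split_sum_cons.
rewrite gapsumD IHs mulrDr -split_sumZ -addrA mulrC; congr (_ + _).
by rewrite -split_sumD.
Qed.

Lemma gapsum_marked M fin k (p : pred T) u s z : ~~ has p s -> p z ->
  gapsum M fin u (fun t => if has p t then k t else 0) (rcons s z) =
  gapsum M M u (fun t => k (rcons t z)) s * fin [::].
Proof.
move=> + pz; elim: s u k => [|x s IHs] u k /=.
  by rewrite pz mul0r addr0 mulrCA mulrA.
rewrite negb_or => /andP[/negPf px ps].
have /= E := IHs [::] (fun t => k (x :: t)) ps.
rewrite (IHs (rcons u x)) // mulrDl -mulrA -E.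
by congr (M u * _ + _); apply: eq_gapsum => // t; rewrite px.
Qed.

End GapSum.

Lemma gapsum_map (C : comNzRingType) (S T : Type) (g : S -> T)
    (M fin h : seq T -> C) u s :
  gapsum M fin (map g u) h (map g s) =
  gapsum (M \o map g) (fin \o map g) u (h \o map g) s.
Proof.
elim: s u h => //= x s IHs u h.
by rewrite -map_rcons IHs (IHs [::] (fun t => h (g x :: t))).
Qed.

(** * Cyclic invariance, Boolean cumulants and rotations through gap sums *)

Section Consequences.
Variables (C : comNzRingType) (T : Type).
Implicit Types (M N c k : seq T -> C) (s t u v : seq T).

(** A block through the last letter leaves nothing after it, so the merged gap [a ++ u] reduces to
    [a], an ordinary first gap. This serves to expand along the block of the last letter. *)
Lemma marked_split_sum M k (p : pred T) s z : M [::] = 1 -> ~~ has p s -> p z ->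
  split_sum (fun a y b => gapsum M (fun u => M (a ++ u)) [::]
    (fun t => if has p (y :: t) then k (y :: t) else 0) b) (rcons s z) =
  gapsum M M [::] (fun t => k (rcons t z)) s.
Proof.
move=> M1 ps pz; rewrite split_sum_rcons [RHS]gapsum_first /= pz cats0 addrC.
congr (_ + _); apply: eq_split_sum => a y b sE.
have [/negPf py pb] : ~~ p y /\ ~~ has p b.
  by move: ps; rewrite sE has_cat /= !negb_or => /and3P[].
have := gapsum_marked M (fun u => M (a ++ u)) (fun t => k (y :: t)) [::] pb pz.
by rewrite /= cats0 mulrC => <-; apply: eq_gapsum => // t; rewrite py.
Qed.

(* Removing the letter x, first or last, together with the rest of its block
   leaves the same gaps: moments and cumulants become cyclic together. *)
Section Cyclic.
Variables M k : seq T -> C.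
Hypothesis M1 : M [::] = 1.
Hypothesis Mfirst : forall x s, M (x :: s) = gapsum M M [::] (fun t => k (x :: t)) s.
Hypothesis Mlast : forall x s, M (rcons s x) = gapsum M M [::] (fun t => k (rcons t x)) s.

Lemma cyclic_cumulants_moments :
  (forall x s, k (x :: s) = k (rcons s x)) -> forall x s, M (x :: s) = M (rcons s x).
Proof. by move=> kc x s; rewrite Mfirst Mlast; apply: eq_gapsum. Qed.

Lemma cyclic_moments_cumulants :
  (forall x s, M (x :: s) = M (rcons s x)) -> forall x s, k (x :: s) = k (rcons s x).
Proof.
move=> Mc x s; have [n] := ubnP (size s); elim: n s => // n IHn s; rewrite ltnS => sn.
(* By induction [d] vanishes on words shorter than [s], so [gapsum_full] leaves [d s] alone. *)
pose d t := k (x :: t) + (-1) * k (rcons t x).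
have : gapsum M M [::] d s = 0.
  by rewrite gapsumD gapsumZ -Mfirst -Mlast Mc mulN1r subrr.
rewrite gapsum_full // /d => [|t ts]; last first.
  by rewrite IHn ?mulN1r ?subrr // (leq_trans ts sn).
by rewrite mulN1r => /eqP; rewrite subr_eq0 => /eqP.
Qed.

End Cyclic.

Lemma cyclic_cat M : (forall x s, M (x :: s) = M (rcons s x)) ->
  forall u v, M (u ++ v) = M (v ++ u).
Proof.
move=> Mc; elim=> [|x u IHu] v; first by rewrite cats0.
by rewrite /= Mc -cats1 -catA cats1 IHu cat_rcons.
Qed.

(** Both expansions of [N (x :: s)] are cut at the last letter of the block of [x], which leaves a
    factor [N b]. By induction the terms with a nonempty tail agree, and the remaining one has
    factor [N [::] = 1]. *)
Lemma bool_cumulant_irreducible M N c beta : M [::] = 1 -> N [::] = 1 ->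
  (forall x s, N (x :: s) = gapsum M N [::] (fun t => c (x :: t)) s) ->
  (forall x s, N (x :: s) =
     gapsum (fun u => (size u == 0)%N%:R) N [::] (fun t => beta (x :: t)) s) ->
  forall x s y,
    beta (x :: rcons s y) = gapsum M M [::] (fun t => c (x :: rcons t y)) s.
Proof.
pose D (u : seq T) : C := (size u == 0)%N%:R.
move=> M1 N1 Nc Nb x.
(* The weight [D] allows only empty gaps, so the block takes every letter, as in an interval
   partition. *)
have gapD u' s h : gapsum D D u' h s = D u' * h s.
  elim: s u' h => [|y s IHs] u' h /=; first by rewrite mulrC.
  by rewrite !IHs /D size_rcons /= mul0r addr0 mul1r.
have E s : c [:: x] * N s +
    split_sum (fun a y b => gapsum M M [::] (fun t => c (x :: rcons t y)) a * N b) s =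
    beta [:: x] * N s + split_sum (fun a y b => beta (x :: rcons a y) * N b) s.
  transitivity (N (x :: s)); first by rewrite Nc gapsum_last.
  rewrite Nb gapsum_last; congr (_ + _); apply: eq_split_sum => a y b _.
  by rewrite gapD mul1r.
have cb : c [:: x] = beta [:: x] by have := E [::]; rewrite /split_sum /= N1 !mulr1 !addr0.
move=> s; have [n] := ubnP (size s); elim: n s => // n IHn s; rewrite ltnS => sn y.
have := E (rcons s y); rewrite cb => /addrI.
rewrite !split_sum_rcons N1 !mulr1 (@eq_split_sum _ _ _
  (fun a z b => beta (x :: rcons a z) * N (rcons b y))) => [/addrI-> //|a z b sE].
by rewrite IHn // (leq_trans _ sn) // sE size_cat /= addnS ltnS leq_addr.
Qed.

(** The cyclic pattern of [Psi]: the word is read from [y] all the way round, with [y] at both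
    ends. *)
Definition rotation_sum c t := split_sum (fun a y b => c (y :: b ++ rcons a y)) t.

(** Each side chooses a set of positions with a distinguished element [y]. The left cuts the cyclic
    word at [y]; the right first picks the leftmost chosen position, then [y]. The gap across the
    end of the word reads [u ++ a] or [a ++ u], whence the cyclicity hypothesis. *)
Lemma rotation_gapsum M c s : (forall u v, M (u ++ v) = M (v ++ u)) ->
  split_sum (fun a y b => gapsum M M [::] (fun t => c (y :: rcons t y)) (b ++ a)) s =
  split_sum (fun a y b => gapsum M (fun u => M (a ++ u)) [::]
    (fun t => rotation_sum c (y :: t)) b) s.
Proof.
move=> Mc; pose F a1 z a2 y b := gapsum M (fun v => M (v ++ a1)) [::]
  (fun t1 => gapsum M M [::] (fun t2 => c (y :: rcons (t1 ++ z :: t2) y)) a2) b.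
transitivity (split_sum (fun a y b => gapsum M (fun u => M (u ++ a)) [::]
    (fun t => c (y :: rcons t y)) b + split_sum (fun a1 z a2 => F a1 z a2 y b) a) s).
  by apply: eq_split_sum => a y b _; rewrite gapsum_cat.
(* After the exchange [z] is the leftmost chosen letter on both sides; the two terms are those where
   [y] is [z] itself and where [y] comes later. *)
rewrite split_sumD split_sum_exchange -split_sumD; apply: eq_split_sum => a z r _.
rewrite (@eq_gapsum _ _ M M (fun u => M (a ++ u)) (fun u => M (u ++ a)) _
  (fun t => c (z :: rcons t z) +
     split_sum (fun a2 y b => c (y :: rcons (b ++ z :: a2) y)) t)) //; last first.
  move=> t; rewrite /rotation_sum split_sum_cons cats1; congr (_ + _).
  by apply: eq_split_sum => a2 y b _; rewrite rcons_cat.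
rewrite gapsumD gapsum_split; congr (_ + _); apply: eq_split_sum => a2 y b _.
exact: gapsum_exchange.
Qed.

End Consequences.

(** * Non-crossing partitions of a subset *)

Section NoncrossingOn.
Variable n : nat.
Implicit Types (A B I V W : {set 'I_n}) (P Q : {set {set 'I_n}}).

(** All pieces live in the same ['I_n], so they are glued by plain union. [NCon setT] is convertible
    to [NC n]. *)
Definition NCon A : {set {set {set 'I_n}}} :=
  [set P | partition P A & noncrossing P].

Lemma noncrossingP P : reflect
  (forall V W (a b c d : 'I_n), V \in P -> W \in P -> a \in V -> b \in W ->
     c \in V -> d \in W -> (a < b < c)%N -> (c < d)%N -> V = W)
  (noncrossing P).
Proof.
apply: (iffP idP) => [nc V W a b c d VP WP aV bW cV dW /andP[ab bc] cd|nc].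
  move/forall_inP: nc => /(_ V VP)/forall_inP/(_ W WP)/forall_inP/(_ a aV).
  move/forall_inP => /(_ b bW)/forall_inP/(_ c cV)/forall_inP/(_ d dW).
  by rewrite ab bc cd => /eqP.
apply/forall_inP => V VP; apply/forall_inP => W WP.
apply/forall_inP => a aV; apply/forall_inP => b bW.
apply/forall_inP => c cV; apply/forall_inP => d dW.
apply/implyP => /and3P[ab bc cd]; apply/eqP.
by apply: (nc V W a b c d) => //; rewrite ab.
Qed.

Lemma consecutiveP I : reflect
  (forall i j l : 'I_n, i \in I -> j \in I -> (i <= l <= j)%N -> l \in I)
  (consecutive I).
Proof.
apply: (iffP idP) => [cI i j l iI jI lij|cI].
  by move/forall_inP: cI => /(_ i iI)/forall_inP/(_ j jI)/forallP/(_ l)/implyP; apply.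
apply/forall_inP => i iI; apply/forall_inP => j jI; apply/forallP => l.
by apply/implyP; apply: cI.
Qed.

Lemma partition_elemP P A : reflect
  [/\ set0 \notin P,
      forall V W (x : 'I_n), V \in P -> W \in P -> x \in V -> x \in W -> V = W,
      forall V (x : 'I_n), V \in P -> x \in V -> x \in A &
      forall x, x \in A -> exists2 V, V \in P & x \in V]
  (partition P A).
Proof.
apply: (iffP and3P) => [[/eqP<- /trivIsetP tiP P0]|[P0 dP sPA cP]]; split => //.
- move=> V W x VP WP xV xW; apply/eqP/negPn/negP => VW.
  by have /disjointFr/(_ xV) := tiP _ _ VP WP VW; rewrite xW.
- by move=> V x VP xV; apply/bigcupP; exists V.
- by move=> x /bigcupP.
- apply/eqP/setP => x; apply/bigcupP/idP => [[V VP xV]|/cP//].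
  exact: sPA xV.
- apply/trivIsetP => V W VP WP; apply: contraNT => /pred0Pn[x /andP[xV xW]].
  by apply/eqP; apply: (dP _ _ x).
Qed.

Definition saturated I P :=
  [forall W in P, (W \subset I) || [disjoint W & I]].

Lemma NConP P A : reflect
  [/\ set0 \notin P,
      forall V W (x : 'I_n), V \in P -> W \in P -> x \in V -> x \in W -> V = W,
      forall V (x : 'I_n), V \in P -> x \in V -> x \in A,
      forall x, x \in A -> exists2 V, V \in P & x \in V &
      forall V W (a b c d : 'I_n), V \in P -> W \in P -> a \in V -> b \in W ->
        c \in V -> d \in W -> (a < b < c)%N -> (c < d)%N -> V = W]
  (P \in NCon A).
Proof.
rewrite inE; apply: (iffP andP) => [[/partition_elemP[? ? ? ?] /noncrossingP ?]//|].
by case=> *; split; [apply/partition_elemP|apply/noncrossingP].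
Qed.

Lemma NCon_block_mem P A V : P \in NCon A -> V \in P -> exists x, x \in V.
Proof. by case/NConP=> P0 _ _ _ _ VP; apply/set0Pn; apply: contraNneq P0 => <-. Qed.

(** A block in [I] and a block off [I] cannot cross: alternation would place a point of the latter
    between two points of the consecutive set [I]. Blocks being nonempty, [powerset I] separates the
    two families again. *)
Lemma NCon_union A I P1 P2 : consecutive I ->
  P1 \in NCon (A :&: I) -> P2 \in NCon (A :\: I) ->
  [/\ P1 :|: P2 \in NCon A, saturated I (P1 :|: P2),
      (P1 :|: P2) :&: powerset I = P1 & (P1 :|: P2) :\: powerset I = P2].
Proof.
move=> /consecutiveP cI N1 N2.
have /NConP[P10 d1 s1 c1 x1] := N1; have /NConP[P20 d2 s2 c2 x2] := N2.
have I1 V x : V \in P1 -> x \in V -> x \in I.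
  by move=> VP /(s1 _ _ VP); rewrite inE => /andP[].
have I2 V x : V \in P2 -> x \in V -> x \notin I.
  by move=> VP /(s2 _ _ VP); rewrite inE => /andP[].
have sub1 V : V \in P1 -> V \subset I by move=> VP; apply/subsetP => x; apply: I1.
have sub2 V : V \in P2 -> V \subset I = false.
  move=> VP; have [x xV] := NCon_block_mem N2 VP.
  by apply/negP => /subsetP/(_ x xV); rewrite (negPf (I2 _ _ VP xV)).
split.
- apply/NConP; split.
  + by rewrite inE negb_or P10.
  + move=> V W x /setUP[] VP /setUP[] WP xV xW; first exact: d1 xW;
      last exact: d2 xW.
    * by have := I2 _ _ WP xW; rewrite (I1 _ _ VP xV).
    * by have := I2 _ _ VP xV; rewrite (I1 _ _ WP xW).
  + by move=> V x /setUP[VP /(s1 _ _ VP)|VP /(s2 _ _ VP)]; rewrite inE => /andP[].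
  + move=> x xA; case: (boolP (x \in I)) => xI.
      have [|V VP xV] := c1 x; first by rewrite inE xA.
      by exists V => //; rewrite inE VP.
    have [|V VP xV] := c2 x; first by rewrite inE xI xA.
    by exists V => //; rewrite inE VP orbT.
  + move=> V W a b c d /setUP[] VP /setUP[] WP aV bW cV dW abc cd.
    * exact: (x1 _ _ _ _ _ _ VP WP aV bW cV dW).
    * have := I2 _ _ WP bW; rewrite (cI a c) ?(I1 _ _ VP) //.
      by case/andP: abc => /ltnW-> /ltnW->.
    * have := I2 _ _ VP cV; rewrite (cI b d) ?(I1 _ _ WP) //.
      by case/andP: abc => _ /ltnW->; rewrite ltnW.
    * exact: (x2 _ _ _ _ _ _ VP WP aV bW cV dW).
- apply/forall_inP => W /setUP[] WP; first by rewrite sub1.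
  apply/orP; right; apply/pred0P => x /=; apply/negP => /andP[xW xI].
  by have := I2 _ _ WP xW; rewrite xI.
- apply/setP => W; rewrite !inE; have [WP|_] /= := boolP (W \in P1).
    by rewrite sub1.
  by case: (boolP (W \in P2)) => //= WP; rewrite sub2.
- apply/setP => W; rewrite !inE; have [WP|_] /= := boolP (W \in P2).
    by rewrite sub2 ?orbT.
  by rewrite orbF; case: (boolP (W \in P1)) => [WP|]; rewrite ?andbF // sub1.
Qed.

Lemma NCon_saturated A I P : P \in NCon A -> saturated I P ->
  P :&: powerset I \in NCon (A :&: I) /\ P :\: powerset I \in NCon (A :\: I).
Proof.
move=> N /forall_inP sat; have /NConP[P0 d s c x] := N.
have satP W y z : W \in P -> y \in W -> z \in W -> y \in I -> z \in I.
  move=> WP yW zW yI; case/orP: (sat W WP) => [/subsetP/(_ z zW)//|].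
  by move/disjointFr => /(_ y yW); rewrite yI.
split; apply/NConP; split.
- by rewrite inE (negPf P0).
- by move=> V W y /setIP[? _] /setIP[? _]; apply: d.
- move=> V y /setIP[VP]; rewrite !inE => /subsetP VI yV.
  by rewrite (s _ _ VP yV) VI.
- move=> y /setIP[/c[V VP yV] yI]; exists V => //; rewrite !inE VP /=.
  by apply/subsetP => z zV; apply: (satP V y).
- by move=> V W a b c' e /setIP[? _] /setIP[? _]; apply: x.
- by rewrite inE (negPf P0) andbF.
- by move=> V W y /setDP[? _] /setDP[? _]; apply: d.
- move=> V y /setDP[VP]; rewrite !inE => /subsetPn[z zV zI] yV.
  by rewrite (s _ _ VP yV) andbT; apply: contra zI; apply: (satP V).
- move=> y /setDP[/c[V VP yV] yI]; exists V => //; rewrite !inE VP andbT.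
  by apply/subsetPn; exists y.
- by move=> V W a b c' e /setDP[? _] /setDP[? _]; apply: x.
Qed.

Lemma big_NCon_saturated (C : nmodType) A I (F : {set {set 'I_n}} -> C) :
  consecutive I ->
  \sum_(P in NCon A | saturated I P) F P =
  \sum_(P1 in NCon (A :&: I)) \sum_(P2 in NCon (A :\: I)) F (P1 :|: P2).
Proof.
move=> cI; rewrite pair_big /=.
rewrite (reindex_onto (fun p => p.1 :|: p.2)
  (fun P => (P :&: powerset I, P :\: powerset I))) /=; last first.
  by move=> P _; rewrite setID.
apply: eq_bigl => -[P1 P2] /=; apply/idP/idP => [|/andP[N1 N2]].
  move=> /andP[/andP[N sat] /eqP[E1 E2]].
  by have [] := NCon_saturated N sat; rewrite E1 E2 => -> ->.
by have [-> -> -> ->] := NCon_union cI N1 N2; rewrite eqxx.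
Qed.

Lemma bmin_le V (i : 'I_n) : i \in V -> (bmin V <= i)%N.
Proof.
move=> iV; rewrite /bmin; have := mem_index_enum i.
elim: (index_enum _) => // j r IHr; rewrite big_cons inE => /predU1P[<-|/IHr ir].
  by rewrite iV geq_minl.
by case: ifP => // _; rewrite geq_min ir orbT.
Qed.

Lemma bmin_mem V (i : 'I_n) : i \in V -> exists2 j : 'I_n, j \in V & bmin V = j.
Proof.
move=> iV; case: (arg_minnP (fun j : 'I_n => j : nat) iV) => j jV jmin.
exists j => //; apply/eqP; rewrite eqn_leq bmin_le //= /bmin.
by apply: (big_ind (fun m => (j <= m)%N)) => [|x y jx jy|//];
  rewrite ?leq_min ?jx ?jy // ltnW.
Qed.

Lemma bmax_ge V (i : 'I_n) : i \in V -> (i <= bmax V)%N.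
Proof. by move=> iV; apply: (@leq_bigmax_cond _ (mem V) (@nat_of_ord n)). Qed.

Lemma bmax_mem V (i : 'I_n) : i \in V -> exists2 j : 'I_n, j \in V & bmax V = j.
Proof.
move=> iV; have V0 : (0 < #|V|)%N by apply/card_gt0P; exists i.
by have [j jV jE] := @eq_bigmax_cond _ (mem V) (@nat_of_ord n) V0; exists j.
Qed.

Lemma innerP P A V : P \in NCon A -> V \in P -> reflect
  (exists W (a b : 'I_n), [/\ W \in P, a \in W, b \in W &
     forall v : 'I_n, v \in V -> (a < v < b)%N])
  (inner P V).
Proof.
move=> N VP; apply: (iffP idP) => [/exists_inP[W WP]|[W [a [b [WP aW bW avb]]]]].
  have [y yW] := NCon_block_mem N WP.
  have [a aW aE] := bmin_mem yW; have [b bW bE] := bmax_mem yW.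
  rewrite aE bE => /and3P[aV _ Vb]; exists W, a, b; split => // u uV.
  by rewrite (leq_trans aV (bmin_le uV)) (leq_ltn_trans (bmax_ge uV) Vb).
have [x xV] := NCon_block_mem N VP.
have [v vV vE] := bmin_mem xV; have [w wV wE] := bmax_mem xV.
apply/exists_inP; exists W => //; apply/and3P; split.
- by rewrite vE (leq_ltn_trans (bmin_le aW)) //; case/andP: (avb v vV).
- exact: leq_trans (bmin_le xV) (bmax_ge xV).
- by rewrite wE; apply: leq_trans (bmax_ge bW); case/andP: (avb w wV).
Qed.

Section Weights.
Variables (C : comNzRingType) (K Kc : {set 'I_n} -> C).

Definition block_weight P W := if inner P W then K W else Kc W.

Definition NC_weight A := \sum_(P in NCon A) \prod_(W in P) block_weight P W.

Definition NC_weight_off A V :=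
  \sum_(P in NCon A | V \in P) \prod_(W in P | W != V) block_weight P W.

Definition NC_weight_free A := \sum_(P in NCon A) \prod_(W in P) K W.

(** A block with points both inside and outside the gap between [q] and [p] would cross [V]. *)
Lemma block_saturated A P V I (q p : 'I_n) : P \in NCon A -> V \in P ->
  q \in V -> p \in V -> I = [set i : 'I_n | q < i < p]%N -> [disjoint V & I] ->
  saturated I P.
Proof.
move=> N VP qV pV -> VI; have /NConP[P0 d s c x] := N.
apply/forall_inP => W WP; have [->|WV] := eqVneq W V; first by rewrite VI orbT.
case: (boolP [disjoint W & _]) => [|/pred0Pn[w /= /andP[wW]]]; first by rewrite orbT.
rewrite inE orbF => /andP[qw wp]; apply/subsetP => y yW; rewrite inE.
have nV z : z \in W -> z \notin V.
  by move=> zW; apply: contra WV => zV; apply/eqP/(d _ _ z).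
case: (ltngtP q y) => [qy|yq|/val_inj qy] /=; last by have := nV _ yW; rewrite -qy qV.
  case: (ltngtP y p) => [//|py|/val_inj yp]; last by have := nV _ yW; rewrite yp pV.
  have VW : V = W by apply: (x V W q w p y); rewrite // qw.
  by have := nV w wW; rewrite VW wW.
have VW : W = V by apply: (x W V y q w p); rewrite // yq.
by have := nV w wW; rewrite -VW wW.
Qed.

(** Blocks in the gap are enclosed by [q] and [p], hence inner, which gives a factor with weights
    [K] alone. The other blocks keep their status, since a block within the gap cannot enclose
    them. *)
Lemma NC_weight_off_gap A V (q p : 'I_n) :
  q \in V -> p \in V -> [disjoint V & [set i : 'I_n | q < i < p]%N] ->
  NC_weight_off A V =
  NC_weight_free (A :&: [set i : 'I_n | q < i < p]%N) *
  NC_weight_off (A :\: [set i : 'I_n | q < i < p]%N) V.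
Proof.
set I := [set i : 'I_n | _] => qV pV VI.
have cI : consecutive I.
  apply/consecutiveP => i j l; rewrite !inE => /andP[qi ip] /andP[qj jp] /andP[il lj].
  by rewrite (leq_trans qi il) (leq_ltn_trans lj jp).
have VnI P1 : P1 \in NCon (A :&: I) -> V \notin P1.
  case/NConP=> _ _ s _ _; apply/negP => /s/(_ qV); rewrite inE => /andP[_].
  by rewrite (disjointFr VI qV).
(* Extension by 0 turns the condition that [V] is a block into a sum over all saturated partitions,
   as [big_NCon_saturated] requires. *)
pose G P := if V \in P then \prod_(W in P | W != V) block_weight P W else 0.
transitivity (\sum_(P in NCon A | saturated I P) G P).
  rewrite [RHS](bigID (fun P => V \in P)) /= [X in _ + X]big1 ?addr0; last first.
    by move=> P /andP[_ /negPf VP]; rewrite /G VP.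
  apply: eq_big => P; last by case/andP=> _ VP; rewrite /G VP.
  apply/andP/andP => [[N VP]|[/andP[? _] ?]] //.
  by rewrite N (block_saturated N VP qV pV (erefl I) VI).
rewrite big_NCon_saturated // mulr_suml; apply: eq_bigr => P1 N1.
rewrite mulr_sumr [RHS]big_mkcondr; apply: eq_bigr => P2 N2.
rewrite /G inE (negPf (VnI _ N1)) /=; case: ifP => // VP2.
have [N _ _ _] := NCon_union cI N1 N2.
have /NConP[_ _ s1 _ _] := N1; have /NConP[_ _ s2 _ _] := N2.
rewrite (bigID (fun W => W \in P1)) /=; congr (_ * _).
  apply: eq_big => [W|W /andP[_ W1]].
    have [W1|_] := boolP (W \in P1); last by rewrite andbF.
    by rewrite inE W1 andbT; apply: contraTneq W1 => ->; apply: VnI.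
  rewrite /block_weight (introT (innerP N _)) ?inE ?W1 //.
  exists V, q, p; split; rewrite ?inE ?VP2 ?orbT // => v vW.
  by have := s1 _ _ W1 vW; rewrite !inE => /andP[].
have nP1 W : W \in P2 -> W \notin P1.
  move=> W2; have [x xW] := NCon_block_mem N2 W2.
  apply/negP => /s1/(_ xW); have := s2 _ _ W2 xW.
  by rewrite !inE => /andP[/negPf-> _]; rewrite andbF.
apply: eq_big => [W|W /andP[/andP[W12 _] W1]].
  rewrite inE; case: (boolP (W \in P2)) => [W2|_]; first by rewrite nP1 // orbT andbT.
  by rewrite orbF; case: (W \in P1); rewrite ?andbF.
have W2 : W \in P2 by move: W12; rewrite inE (negPf W1).
congr (if _ then _ else _); apply/(innerP N W12)/(innerP N2 W2).
  case=> U [a [b [/setUP[U1|U2] aU bU avb]]]; last by exists U, a, b.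
  have [x xW] := NCon_block_mem N2 W2.
  have /andP[ax xb] := avb x xW; have := s2 _ _ W2 xW; rewrite inE => /andP[/negP[]].
  have /setIP[_ aI] := s1 _ _ U1 aU; have /setIP[_ bI] := s1 _ _ U1 bU.
  by move/consecutiveP: cI => /(_ a b x aI bI); apply; rewrite (ltnW ax) (ltnW xb).
by case=> U [a [b [U2 *]]]; exists U, a, b; split; rewrite // inE U2 orbT.
Qed.

Lemma NCon1 V P : V != set0 -> V \in P -> (P \in NCon V) = (P == [set V]).
Proof.
move=> V0 VP; apply/idP/eqP => [/NConP[P0 d s c _]|->].
  apply/setP => W; rewrite inE; apply/idP/eqP => [WP|->//].
  have /set0Pn[x xW] : W != set0 by apply: contraNneq P0 => <-.
  exact: (d _ _ x WP VP xW (s _ _ WP xW)).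
apply/NConP; split; first by rewrite inE eq_sym.
- by move=> U W x /set1P-> /set1P->.
- by move=> U x /set1P->.
- by move=> x xV; exists V => //; rewrite inE.
- by move=> U W a b c d /set1P-> /set1P->.
Qed.

(** Since [V] is all of [A] inside [I], deleting it leaves an arbitrary non-crossing partition of
    [A :\: I]; the last hypothesis keeps the weights of the other blocks. *)
Lemma NC_weight_off_interval A V I : V != set0 -> consecutive I -> A :&: I = V ->
  (forall P W, P \in NCon A -> V \in P -> W \in P -> W != V ->
     block_weight P W = block_weight (P :\ V) W) ->
  NC_weight_off A V = NC_weight (A :\: I).
Proof.
move=> V0 cI AIV wE.
have [v vV] := set0Pn _ V0.
have VI : V \subset I by rewrite -AIV subsetIr.
pose G P := if V \in P then \prod_(W in P | W != V) block_weight P W else 0.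
transitivity (\sum_(P in NCon A | saturated I P) G P).
  rewrite [RHS](bigID (fun P => V \in P)) /= [X in _ + X]big1 ?addr0; last first.
    by move=> P /andP[_ /negPf VP]; rewrite /G VP.
  apply: eq_big => P; last by case/andP=> _ VP; rewrite /G VP.
  apply/andP/andP => [[N VP]|[/andP[? _] ?]] //; split=> //; rewrite N /=.
  have /NConP[P0 d s _ _] := N; apply/forall_inP => W WP.
  have [->|WV] := eqVneq W V; first by rewrite VI.
  apply/orP; right; apply/pred0P => x /=; apply: contra_neqF WV => /andP[xW xI].
  by apply: (d _ _ x) => //; rewrite -AIV inE (s _ _ WP xW).
rewrite big_NCon_saturated // AIV.
have N1 : [set V] \in NCon V by rewrite NCon1 ?inE.
rewrite (bigD1 [set V]) //= [X in _ + X]big1 ?addr0; last first.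
  move=> P1 /andP[NP1 P1V]; apply: big1 => P2 N2; rewrite /G inE.
  have VP1 : V \notin P1 by apply: contra P1V => VP1; rewrite -NCon1.
  rewrite (negPf VP1) /=; case: ifP => // VP2.
  have /NConP[_ _ s _ _] := N2; have := s _ _ VP2 vV.
  by rewrite inE (subsetP VI _ vV).
apply: eq_bigr => P2 N2; rewrite /G !inE eqxx /=.
have VP2 : V \notin P2.
  by apply/negP => VP2; have /NConP[_ _ s _ _] := N2; have := s _ _ VP2 vV;
    rewrite inE (subsetP VI _ vV).
have N1' : [set V] \in NCon (A :&: I) by rewrite AIV.
have [N _ _ _] := NCon_union cI N1' N2.
have P2E : ([set V] :|: P2) :\ V = P2.
  by rewrite setDUl setDv set0U; apply/setDidPl; rewrite disjoint_sym disjoints1.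
apply: eq_big => [W|W /andP[WP WV]].
  by rewrite !inE; case: eqVneq => [->|]; rewrite ?(negPf VP2) ?andbT.
by rewrite wE ?P2E // !inE eqxx.
Qed.

End Weights.

Lemma NC_weight_free_diag (C : comNzRingType) (K : {set 'I_n} -> C) A :
  NC_weight K K A = NC_weight_free K A.
Proof.
by apply: eq_bigr => P _; apply: eq_bigr => W _; rewrite /block_weight if_same.
Qed.

(** Lying to the left of all remaining points, [V] encloses no other block, so its deletion changes
    no status. *)
Lemma NC_weight_off_min (C : comNzRingType) (K Kc : {set 'I_n} -> C) A V I :
  V != set0 -> consecutive I -> A :&: I = V ->
  (forall v w, v \in V -> w \in A :\: I -> v < w)%N ->
  NC_weight_off K Kc A V = NC_weight K Kc (A :\: I).
Proof.
move=> V0 cI AIV ltV; apply: NC_weight_off_interval => // P W N VP WP WV.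
have /NConP[P0 d s c x] := N.
have VD : P :\ V = P :\: powerset I.
  apply/setP => U; rewrite !inE; case: (boolP (U \in P)) => [UP|]; rewrite ?andbF //.
  rewrite !andbT; congr (~~ _); apply/eqP/idP => [->|/subsetP UI].
    by rewrite -AIV subsetIr.
  have [u uU] := NCon_block_mem N UP; apply: (d _ _ u) => //.
  by rewrite -AIV inE (s _ _ UP uU) UI.
have [|_ N2] := @NCon_saturated A I P N.
  apply/forall_inP => U UP; have [->|UV] := eqVneq U V.
    by rewrite -AIV subsetIr.
  apply/orP; right; apply/pred0P => y /=; apply: contra_neqF UV => /andP[yU yI].
  by apply: (d _ _ y) => //; rewrite -AIV inE (s _ _ UP yU).
rewrite -VD in N2; have W2 : W \in P :\ V by rewrite !inE WV.
congr (if _ then _ else _); apply/(innerP N WP)/(innerP N2 W2).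
  case=> U [a [b [UP aU bU avb]]]; exists U, a, b; split => //.
  rewrite !inE UP andbT; apply/eqP => UV.
  have [y yW] := NCon_block_mem N WP; have /andP[_] := avb y yW.
  rewrite ltnNge (ltnW (ltV b y _ _)) //; first by rewrite -UV.
  by have /NConP[_ _ s2 _ _] := N2; apply: s2 yW.
by case=> U [a [b [/setD1P[_ UP] *]]]; exists U, a, b.
Qed.

End NoncrossingOn.

(** * Increasing enumerations of sets of ordinals *)

Section EnumOrdinals.

Lemma ltn_ord_trans n : transitive (fun i j : 'I_n => (i < j)%N).
Proof. by move=> y x z; apply: ltn_trans. Qed.

Lemma enum_ord_sorted n (A : {set 'I_n}) :
  sorted (fun i j : 'I_n => (i < j)%N) (enum A).
Proof.
have -> : enum A = filter [in A] (enum 'I_n) by rewrite enumT.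
apply: sorted_filter; first exact: ltn_ord_trans.
by have := iota_ltn_sorted 0 n; rewrite -val_enum_ord sorted_map.
Qed.

Lemma enum_ord_eq n (A : {set 'I_n}) (e : seq 'I_n) :
  sorted (fun i j : 'I_n => (i < j)%N) e -> e =i A -> enum A = e.
Proof.
move=> se eA; apply: (irr_sorted_eq (@ltn_ord_trans n) _ (enum_ord_sorted A) se).
  by move=> i; rewrite /= ltnn.
by move=> i; rewrite mem_enum eA.
Qed.

Lemma enum_setU_lt n (A B : {set 'I_n}) :
  (forall a b, a \in A -> b \in B -> (a < b)%N) ->
  enum (A :|: B) = enum A ++ enum B.
Proof.
move=> ltAB; apply: enum_ord_eq; last by move=> i; rewrite mem_cat !mem_enum inE.
rewrite (sorted_pairwise (@ltn_ord_trans n)) pairwise_cat.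
rewrite -!(sorted_pairwise (@ltn_ord_trans n)) !enum_ord_sorted !andbT.
by apply/allrelP => a b; rewrite !mem_enum; apply: ltAB.
Qed.

Lemma enum_imset_mono n m (f : 'I_n -> 'I_m) (A : {set 'I_n}) :
  (forall i j : 'I_n, (i < j)%N -> (f i < f j)%N) ->
  enum (f @: A) = map f (enum A).
Proof.
move=> fm; apply: enum_ord_eq.
  by rewrite sorted_map; apply: sub_sorted (enum_ord_sorted A) => i j; exact: fm.
move=> i; apply/mapP/imsetP => -[j jA ->]; exists j => //.
  by rewrite -mem_enum.
by rewrite mem_enum.
Qed.

End EnumOrdinals.

(** * Transport of partition sums along increasing maps *)

Section Transfer.
Variables (C : comNzRingType) (m n : nat) (f : 'I_m -> 'I_n).
Hypothesis f_mono : forall i j : 'I_m, (i < j)%N -> (f i < f j)%N.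
Implicit Types (P : {set {set 'I_m}}) (V W A : {set 'I_m}).

Lemma ltn_mono i j : (f i < f j)%N = (i < j)%N.
Proof.
apply/idP/idP => [|/f_mono//]; apply: contraTT; rewrite -!leqNgt leq_eqVlt.
by case/predU1P => [/val_inj->//|/f_mono/ltnW].
Qed.

Lemma ord_mono_inj : injective f.
Proof.
by move=> i j ij; apply/val_inj; case: (ltngtP i j) => // /f_mono; rewrite ij ltnn.
Qed.

Lemma NCon_imset P A :
  ([set f @: V | V : {set 'I_m} in P] \in NCon (f @: A)) = (P \in NCon A).
Proof.
have fI := ord_mono_inj.
apply/idP/idP => /NConP[P0 d s c x]; apply/NConP; split.
- by apply: contra P0 => P0; apply/imsetP; exists set0; rewrite ?imset0.
- move=> V W y VP WP yV yW; apply: (imset_inj fI).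
  by apply: (d _ _ (f y)); rewrite ?mem_imset //; apply: imset_inj.
- move=> V y VP yV; rewrite -(mem_imset _ _ fI); apply: (s (f @: V));
    by rewrite mem_imset //; apply: imset_inj.
- move=> y yA; have [|U /imsetP[V VP ->]] := c (f y); first by rewrite mem_imset.
  by rewrite mem_imset // => yV; exists V.
- move=> V W a b e h VP WP aV bW eV hW ab eh; apply: (imset_inj fI).
  apply: (x _ _ (f a) (f b) (f e) (f h)); rewrite ?ltn_mono ?mem_imset //;
    exact: imset_inj.
- by apply/imsetP => -[V VP /esym/eqP]; rewrite imset_eq0 => /eqP V0; rewrite -V0 VP in P0.
- move=> _ _ y /imsetP[V VP ->] /imsetP[W WP ->] /imsetP[v vV ->].
  by rewrite mem_imset // => vW; rewrite (d _ _ _ VP WP vV vW).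
- move=> _ y /imsetP[V VP ->] /imsetP[v vV ->]; rewrite mem_imset //.
  exact: s vV.
- move=> _ /imsetP[y yA ->]; have [V VP yV] := c _ yA.
  by exists (f @: V); rewrite mem_imset //; apply: imset_inj.
- move=> _ _ _ _ _ _ /imsetP[V VP ->] /imsetP[W WP ->]
    /imsetP[a aV ->] /imsetP[b bW ->] /imsetP[e eV ->] /imsetP[h hW ->].
  by rewrite !ltn_mono => ab eh; rewrite (x V W a b e h).
Qed.

Lemma inner_imset P A V : P \in NCon A -> V \in P ->
  inner [set f @: U | U : {set 'I_m} in P] (f @: V) = inner P V.
Proof.
move=> N VP; have N' := N; rewrite -NCon_imset in N'.
have VP' := imset_f (fun U : {set 'I_m} => f @: U) VP.
apply/(innerP N' VP')/(innerP N VP) => [[U [a' [b' [UP aU bU avb]]]]|].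
  have /imsetP[W WP UE] := UP; move: aU bU; rewrite UE.
  case/imsetP=> a aW aE /imsetP[b bW bE]; exists W, a, b; split => // v vV.
  by rewrite -!ltn_mono -aE -bE; apply/avb/imset_f.
move=> [W [a [b [WP aW bW avb]]]]; exists (f @: W), (f a), (f b).
split; try exact: imset_f.
by move=> _ /imsetP[v vV ->]; rewrite !ltn_mono; apply: avb.
Qed.

Lemma NC_weight_imset (K Kc : {set 'I_n} -> C) A :
  NC_weight K Kc (f @: A) =
  NC_weight (fun V => K (f @: V)) (fun V => Kc (f @: V)) A.
Proof.
have fI := ord_mono_inj.
rewrite /NC_weight (reindex_onto (fun P => [set f @: V | V : {set 'I_m} in P])
  (fun Q => [set f @^-1: V | V : {set 'I_n} in Q])) /=; last first.
  (* Every block of [Q] lies in the range of [f], so preimage followed by image restores it. *)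
  move=> Q /NConP[_ _ s _ _]; rewrite -imset_comp -[RHS]imset_id.
  apply: eq_in_imset => V VQ /=; apply/setP => y; apply/imsetP/idP.
    by case=> x; rewrite inE => + ->.
  move=> yV; have /imsetP[x xA yE] := s _ _ VQ yV.
  by exists x; rewrite // inE -yE.
apply: eq_big => [P|P /andP[N _]].
  rewrite NCon_imset -imset_comp -[X in _ == X]imset_id.
  rewrite (eq_in_imset (g := id)) ?eqxx ?andbT // => V _ /=.
  by apply/setP => x; rewrite inE mem_imset.
rewrite NCon_imset in N; rewrite big_imset /=; last by move=> V W _ _; apply: imset_inj.
by apply: eq_bigr => W WP; rewrite /block_weight (inner_imset N).
Qed.

End Transfer.

(** * Partition sums expanded along one block and its gaps *)

Section GapDecomposition.
Variables (C : comNzRingType) (n : nat) (K Kc : {set 'I_n} -> C) (i : 'I_n).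
Variables (M fin h : seq 'I_n -> C).
Implicit Types (V : {set 'I_n}) (p q : 'I_n).
Hypothesis ME : forall B : {set 'I_n}, M (enum B) = NC_weight_free K B.
Hypothesis finE : forall q, (i <= q)%N -> fin (enum [set j : 'I_n | q < j]%N) =
  NC_weight K Kc ([set j : 'I_n | j < i]%N :|: [set j : 'I_n | q < j]%N).
(** Equal weights serve the infinitesimal expansion, where status is immaterial; [i = 0] serves the
    c-free one, where the chosen block has nothing on its left. *)
Hypothesis Kc_min : K = Kc \/ i = 0%N :> nat.

(* What is left of the index set once the gaps of V before its element q, except
   the one before its minimum i, have been removed. *)
Definition hull V q :=
  [set j : 'I_n | j < i]%N :|: V :|: [set j : 'I_n | q < j]%N.

Lemma NC_weight_off_hull V q : i \in V -> q \in V ->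
  (forall v, v \in V -> i <= v <= q)%N ->
  NC_weight_off K Kc (hull V q) V = fin (enum [set j : 'I_n | q < j]%N).
Proof.
move=> iV qV iVq; have /andP[iq _] := iVq _ qV.
pose I := [set j : 'I_n | i <= j <= q]%N.
have V0 : V != set0 by apply/set0Pn; exists i.
have cI : consecutive I.
  apply/consecutiveP => a b l; rewrite !inE => /andP[ia _] /andP[_ bq] /andP[al lb].
  by rewrite (leq_trans ia al) (leq_trans lb bq).
have AI : hull V q :&: I = V.
  apply/setP => v; rewrite !inE; case: (boolP (v \in V)) => [/iVq|_].
    by case/andP=> -> ->; rewrite orbT.
  by apply/negP => /andP[+ /andP[iv vq]]; rewrite orbF !ltnNge iv vq.
have AD : hull V q :\: I = [set j : 'I_n | j < i]%N :|: [set j : 'I_n | q < j]%N.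
  apply/setP => v; rewrite !inE negb_and -!ltnNge; case: (boolP (v \in V)) => [/iVq|_].
    by rewrite !ltnNge => /andP[-> ->].
  by rewrite orbF andbb.
rewrite finE // -AD; case: Kc_min => [KKc|i0].
  apply: (NC_weight_off_interval V0 cI AI) => P W _ _ _ _.
  by rewrite /block_weight KKc !if_same.
apply: (NC_weight_off_min _ _ V0 cI AI) => v w /iVq/andP[_ vq].
by rewrite AD !inE i0 ltn0 /=; apply: leq_ltn_trans.
Qed.

(** Here [p] is the next position to read, [V] the part of the block [W] chosen so far, [q] its last
    element, and the accumulator the gap open since [q]. The induction is on the number of unread
    positions. *)
Lemma gapsum_hull V q (p : nat) : i \in V -> q \in V ->
  (forall v, v \in V -> i <= v <= q)%N -> (q < p <= n)%N ->
  gapsum M fin (enum [set j : 'I_n | q < j < p]%N) (fun t => h (enum V ++ t))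
    (enum [set j : 'I_n | p <= j]%N) =
  \sum_(W : {set 'I_n} | W :&: [set j : 'I_n | j < p]%N == V)
    h (enum W) * NC_weight_off K Kc (hull V q) W.
Proof.
have [m] := ubnP (n - p); elim: m V q p => // m IHm V q p.
rewrite ltnS => npm iV qV iVq /andP[qp]; rewrite leq_eqVlt => /predU1P[pn|pn].
  have -> : [set j : 'I_n | p <= j]%N = set0.
    by apply/setP => j; rewrite !inE pn leqNgt ltn_ord.
  have -> : [set j : 'I_n | q < j < p]%N = [set j : 'I_n | q < j]%N.
    by apply/setP => j; rewrite !inE pn ltn_ord andbT.
  rewrite enum_set0 /= cats0 (big_pred1 V) ?NC_weight_off_hull // => W /=.
  congr (_ == _); apply/setIidPl/subsetP => j _; by rewrite inE pn.
pose p' := Ordinal pn.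
have ltVp v : v \in V -> (v < p)%N by move/iVq/andP=> [_ /leq_ltn_trans->].
have pV : p' \notin V by apply/negP => /ltVp; rewrite ltnn.
have -> : [set j : 'I_n | p <= j]%N = p' |: [set j : 'I_n | p'.+1 <= j]%N.
  by apply/setP => j; rewrite !inE leq_eqVlt -val_eqE eq_sym.
rewrite enum_setU_lt => [|a b /set1P->]; last by rewrite inE.
rewrite enum_set1 /= ME.
(* Either [p] belongs to [W], which closes the gap after [q] and factors it out, or the gap grows by
   [p]. *)
rewrite (bigID (fun W : {set 'I_n} => p' \in W)) /=; congr (_ + _).
  pose I := [set j : 'I_n | q < j < p']%N.
  transitivity (NC_weight_free K I * \sum_(W : {set 'I_n} |
      W :&: [set j : 'I_n | j < p'.+1]%N == p' |: V)
      h (enum W) * NC_weight_off K Kc (hull (p' |: V) p') W).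
    congr (_ * _); rewrite -IHm.
    - have -> : [set j : 'I_n | p' < j < p'.+1]%N = set0.
        by apply/setP => j; rewrite !inE ltnS; case: ltngtP.
      rewrite enum_set0; apply: eq_gapsum => // t.
      rewrite setUC enum_setU_lt ?enum_set1 -?catA // => a b /ltVp + /set1P->.
      by [].
    - by rewrite (leq_trans _ npm) // ltn_sub2l.
    - by rewrite inE iV orbT.
    - by rewrite !inE eqxx.
    - move=> v /setU1P[->|vV]; first by rewrite leqnn (leq_trans _ (ltnW qp)) //; case/andP: (iVq _ qV).
      by have /andP[-> _] := iVq _ vV; rewrite ltnW ?ltVp.
    - by rewrite ltnSn.
  rewrite mulr_sumr; apply: eq_big => [W|W /eqP WE].
    apply/eqP/andP => [WE|[/eqP WE pW]].
      have pW : p' \in W.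
        have : p' \in p' |: V by rewrite !inE eqxx.
        by rewrite -WE => /setIP[].
      split=> //; apply/eqP/setP => j; move/setP/(_ j): WE.
      rewrite !inE ltnS (leq_eqVlt j p) -val_eqE /=; case: eqP => /= [jp|_ ->//].
      have -> : j = p' by apply: val_inj.
      by rewrite ltnn andbF (negPf pV).
    apply/setP => j; move/setP/(_ j): WE.
    rewrite !inE ltnS (leq_eqVlt j p) -val_eqE /=.
    case: eqP => /= [jp|_ ->//].
    have -> : j = p' by apply: val_inj.
    by rewrite pW.
  have pW : p' \in W.
    have : p' \in p' |: V by rewrite !inE eqxx.
    by rewrite -WE => /setIP[].
  have qW : q \in W.
    have : q \in p' |: V by rewrite !inE qV orbT.
    by rewrite -WE => /setIP[].
  have VnI v : v \in p' |: V -> v \notin I.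
    rewrite !inE; case/predU1P=> [->|/iVq/andP[_ vq]]; first by rewrite ltnn andbF.
    by rewrite ltnNge vq.
  have WI : [disjoint W & I].
    apply/pred0P => j /=; apply/negP => /andP[jW jI].
    have /VnI : j \in p' |: V; last by rewrite jI.
    by rewrite -WE inE jW inE ltnS; move: jI; rewrite inE => /andP[_ /ltnW].
  rewrite mulrCA; congr (_ * _).
  rewrite [RHS](NC_weight_off_gap _ _ _ qW pW WI); congr (_ * _).
    congr NC_weight_free; apply/setP => j; rewrite !inE.
    by case: (q < j)%N; rewrite ?orbT // andbF.
  (* Removing the closed gap from the hull of [V] yields the hull of [p' |: V], whose last element
     is [p']. *)
  congr (NC_weight_off _ _ _ W); apply/setP => j; rewrite !inE -val_eqE /=.
  case: (boolP (j \in V)) => [/[dup] /ltVp jp /iVq/andP[_]|jV].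
    by rewrite !orbT /= leqNgt => /negPf->.
  rewrite !orbF; case: (ltngtP j p) => [jp|pj|->] /=.
  - rewrite orbF andbT; case: (leqP j q) => [_|qj]; first by rewrite orbF.
    by rewrite ltnNge (leq_trans _ (ltnW qj)) //; case/andP: (iVq _ qV).
  - by rewrite andbF (ltn_trans qp pj) !orbT.
  - by rewrite qp !orbT.
have -> : rcons (enum [set j : 'I_n | q < j < p]%N) p' =
    enum [set j : 'I_n | q < j < p.+1]%N.
  rewrite -cats1 -enum_set1 -enum_setU_lt => [|a b]; last first.
    by rewrite !inE => /andP[_ ap] /eqP->.
  apply: eq_enum => j; rewrite !inE ltnS (leq_eqVlt j p) -val_eqE /=.
  by case: (ltngtP j p) => [_|_|->]; rewrite ?orbF ?andbF ?andbT ?qp ?orbT.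
rewrite IHm ?(ltnW (leq_ltn_trans _ qp)) //; first last.
- by rewrite ltnS (ltnW qp).
- by rewrite (leq_trans _ npm) // ltn_sub2l.
apply: eq_bigl => W; apply/eqP/andP => [WE|[/eqP WE pW]].
  have pW : p' \notin W.
    by apply: contra pV => pW; rewrite -WE !inE pW /=.
  split=> //; apply/eqP/setP => j; move/setP/(_ j): WE.
  rewrite !inE ltnS (leq_eqVlt j p); case: eqP => //= jp.
  have -> : j = p' by apply: val_inj.
  by rewrite ltnn andbF (negPf pV).
apply/setP => j; move/setP/(_ j): WE; rewrite !inE ltnS (leq_eqVlt j p).
case: eqP => //= jp; have -> : j = p' by apply: val_inj.
by rewrite (negPf pW).
Qed.

End GapDecomposition.

Section SetDecomposition.
Variables (C : comNzRingType) (n : nat) (K Kc : {set 'I_n} -> C).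
Implicit Types V W : {set 'I_n}.

(** The condition on [W] says that its minimum is [i]. The recursion of [gapsum_hull] starts from
    [[set i]] and an empty gap, where the hull is the whole index set. *)
Lemma sum_NC_weight_off_min (i : 'I_n) (M fin h : seq 'I_n -> C) :
  (forall B : {set 'I_n}, M (enum B) = NC_weight_free K B) ->
  (forall q : 'I_n, (i <= q)%N -> fin (enum [set j : 'I_n | q < j]%N) =
     NC_weight K Kc ([set j : 'I_n | j < i]%N :|: [set j : 'I_n | q < j]%N)) ->
  K = Kc \/ i = 0%N :> nat ->
  \sum_(W : {set 'I_n} | W :&: [set j : 'I_n | j < i.+1]%N == [set i])
    h (enum W) * NC_weight_off K Kc setT W =
  gapsum M fin [::] (fun t => h (i :: t)) (enum [set j : 'I_n | i < j]%N).
Proof.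
move=> ME finE Kmin.
have hT : setT = hull i [set i] i.
  by apply/setP => j; rewrite !inE -val_eqE; case: ltngtP.
rewrite hT -(gapsum_hull _ ME finE Kmin) ?inE ?ltn_ord ?ltnSn // => [|v].
  have -> : [set j : 'I_n | i < j < i.+1]%N = set0.
    by apply/setP => j; rewrite !inE ltnS; case: ltngtP.
  by rewrite enum_set0 enum_set1.
by move/set1P->; rewrite leqnn.
Qed.

(** Exactly one block contains 0, and nothing can enclose it, so its factor is [Kc]. *)
Lemma NC_weight_block0 (i : 'I_n) : i = 0%N :> nat ->
  NC_weight K Kc setT =
  \sum_(W : {set 'I_n} | W :&: [set j : 'I_n | j < i.+1]%N == [set i])
    Kc W * NC_weight_off K Kc setT W.
Proof.
move=> i0.
have lt1 (j : 'I_n) : (j < i.+1)%N = (j == i).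
  by rewrite -val_eqE /= i0 ltnS leqn0.
have iW W : (W :&: [set j : 'I_n | j < i.+1]%N == [set i]) = (i \in W).
  apply/eqP/idP => [/setP/(_ i)|iW]; first by rewrite !inE eqxx ltnSn andbT.
  by apply/setP => j; rewrite !inE lt1; case: eqP => [->|]; rewrite ?andbT ?andbF.
rewrite (eq_bigl _ _ iW).
under [RHS]eq_bigr do rewrite mulr_sumr big_mkcondr.
rewrite exchange_big; apply: eq_bigr => P N; rewrite -big_mkcondr.
have /NConP[_ d _ c _] := N; have [V VP iV] := c i (in_setT i).
rewrite [RHS](big_pred1 V) => [|W /=]; last first.
  apply/andP/eqP => [[iW' WP]|->//]; exact: (d _ _ i).
rewrite (bigD1 V) //= /block_weight ifN //; apply/negP.
case/(innerP N VP) => W [a [b [_ _ _ /(_ i iV)]]].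
by rewrite i0 ltn0.
Qed.

Lemma sum_min_element (F : {set 'I_n} -> C) : F set0 = 0 ->
  \sum_(V : {set 'I_n}) F V =
  \sum_(i < n) \sum_(V : {set 'I_n} | V :&: [set j : 'I_n | j < i.+1]%N == [set i]) F V.
Proof.
move=> F0; under [RHS]eq_bigr do rewrite big_mkcond.
rewrite exchange_big; apply: eq_bigr => V _; rewrite -big_mkcond.
have [->|/set0Pn[v vV]] := eqVneq V set0; first by rewrite F0 big1.
case: (arg_minnP (fun j : 'I_n => j : nat) vV) => i iV' imin; have iV : i \in V := iV'.
rewrite (big_pred1 i) // => k /=; apply/eqP/eqP => [VE|->].
  have kV : k \in V by have := set11 k; rewrite -VE => /setIP[].
  apply/val_inj/eqP; rewrite eqn_leq imin // andbT leqNgt; apply/negP => ik.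
  have : i \in [set k] by rewrite -VE !inE iV ltnS ltnW.
  by rewrite inE => /eqP ik'; rewrite ik' ltnn in ik.
apply/setP => j; rewrite !inE ltnS; apply/andP/eqP => [[jV ji]|->//].
by apply/val_inj/eqP; rewrite eqn_leq ji imin.
Qed.

End SetDecomposition.

(** * Moment-cumulant sums of words as gap sums *)

Section Words.
Variables (C : comNzRingType) (T : Type).
Implicit Types (kappa : seq T -> C) (s : seq T).

Lemma restrE s (V : {set 'I_(size s)}) :
  restr V = map (tnth (in_tuple s)) (enum V).
Proof.
rewrite /restr -[X in mask _ X](map_tnth_enum (in_tuple s)) -map_mask -filter_mask.
by rewrite [in RHS]/enum_mem -enumT.
Qed.

Lemma map_enum_drop s k :
  map (tnth (in_tuple s)) (enum [set j : 'I_(size s) | k <= j]%N) = drop k s.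
Proof.
rewrite -[X in drop _ X](map_tnth_enum (in_tuple s)) -map_drop; congr map.
apply: enum_ord_eq => [|j].
  apply: (subseq_sorted (@ltn_ord_trans _) (drop_subseq _ _)).
  by have := iota_ltn_sorted 0 (size s); rewrite -val_enum_ord sorted_map.
rewrite inE -(mem_map val_inj) map_drop val_enum_ord drop_iota mem_iota add0n.
apply: andb_idr => kj; have jn := ltn_ord j.
by rewrite subnKC // (leq_trans kj) // ltnW.
Qed.

Lemma map_enum_take s k :
  map (tnth (in_tuple s)) (enum [set j : 'I_(size s) | j < k]%N) = take k s.
Proof.
rewrite -[X in take _ X](map_tnth_enum (in_tuple s)) -map_take; congr map.
apply: enum_ord_eq => [|j].
  apply: (subseq_sorted (@ltn_ord_trans _) (take_subseq _ _)).
  by have := iota_ltn_sorted 0 (size s); rewrite -val_enum_ord sorted_map.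
rewrite inE -(mem_map val_inj) map_take val_enum_ord take_iota mem_iota add0n.
by rewrite /= leq_min ltn_ord andbT.
Qed.

Lemma cfree_sumE kappa kappac s : cfree_sum kappa kappac s =
  NC_weight (fun V : {set 'I_(size s)} => kappa (restr V))
            (fun V : {set 'I_(size s)} => kappac (restr V)) setT.
Proof.
apply: eq_bigr => P _; rewrite [RHS](bigID (inner P)) /=; congr (_ * _).
  by apply: eq_bigr => V /andP[_ iV]; rewrite /block_weight iV.
by apply: eq_bigr => V /andP[_ /negPf oV]; rewrite /block_weight oV.
Qed.

Lemma cfree_sum_diag kappa s : cfree_sum kappa kappa s = free_sum kappa s.
Proof.
by apply: eq_bigr => P _; rewrite [RHS](bigID (inner P)).
Qed.

(** The increasing enumeration of [B] identifies it with the positions of the extracted word, and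
    [NC_weight_imset] transports the sum. *)
Lemma NC_weight_word kappa kappac s (B : {set 'I_(size s)}) :
  NC_weight (fun V : {set 'I_(size s)} => kappa (restr V))
            (fun V : {set 'I_(size s)} => kappac (restr V)) B =
  cfree_sum kappa kappac (map (tnth (in_tuple s)) (enum B)).
Proof.
set s' := map _ _; have s'E : size s' = size (enum B) by rewrite size_map.
pose f (i : 'I_(size s')) := tnth (in_tuple (enum B)) (cast_ord s'E i).
have fE x0 i : f i = nth x0 (enum B) i by rewrite /f (tnth_nth x0).
have f_mono (i j : 'I_(size s')) : (i < j)%N -> (f i < f j)%N.
  move=> ij; have x0 := f i; rewrite !(fE x0).
  by apply: (sorted_ltn_nth (@ltn_ord_trans _) _ (enum_ord_sorted B));
    rewrite // inE -s'E ltn_ord.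
have fB : B = f @: setT.
  apply/setP => x; apply/idP/imsetP => [xB|[i _ ->]]; last first.
    by rewrite -mem_enum mem_tnth.
  have xs : (index x (enum B) < size s')%N by rewrite s'E index_mem mem_enum.
  by exists (Ordinal xs); rewrite // (fE x) /= nth_index ?mem_enum.
rewrite cfree_sumE [in LHS]fB (NC_weight_imset f_mono).
have rE (V : {set 'I_(size s')}) : restr (f @: V) = restr V.
  rewrite !restrE (enum_imset_mono _ f_mono) -map_comp; apply: eq_map => i /=.
  by rewrite [RHS](tnth_nth (tnth (in_tuple s) (f i))) /= (nth_map (f i)) -?s'E // -fE.
by apply: eq_bigr => P _; apply: eq_bigr => V _; rewrite /block_weight rE.
Qed.

Lemma NC_weight_free_word kappa s (B : {set 'I_(size s)}) :
  NC_weight_free (fun V : {set 'I_(size s)} => kappa (restr V)) B =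
  free_sum kappa (map (tnth (in_tuple s)) (enum B)).
Proof. by rewrite -NC_weight_free_diag NC_weight_word cfree_sum_diag. Qed.

(** A gap followed by a later letter of the first block holds inner blocks only, hence a free
    moment; the last gap is not enclosed and keeps its c-free moment. *)
Lemma cfree_sum_cons kappa kappac x s :
  cfree_sum kappa kappac (x :: s) =
  gapsum (free_sum kappa) (cfree_sum kappa kappac) [::] (fun t => kappac (x :: t)) s.
Proof.
pose t := tnth (in_tuple (x :: s)); pose i : 'I_(size (x :: s)) := ord0.
rewrite cfree_sumE (@NC_weight_block0 _ _ _ _ i) //.
rewrite (eq_bigr (fun W : {set 'I_(size (x :: s))} => (kappac \o map t) (enum W) * NC_weight_off
  (fun V : {set 'I_(size (x :: s))} => kappa (restr V))
  (fun V : {set 'I_(size (x :: s))} => kappac (restr V)) setT W)); last first.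
  by move=> W _; rewrite /= restrE.
rewrite (@sum_NC_weight_off_min _ _ _ _ i (free_sum kappa \o map t)
  (cfree_sum kappa kappac \o map t)); first last.
- by right.
- move=> q _; rewrite NC_weight_word.
  have -> : [set j : 'I_(size (x :: s)) | j < i]%N = set0.
    by apply/setP => j; rewrite !inE.
  by rewrite set0U.
- by move=> B; rewrite NC_weight_free_word.
have := map_enum_drop (x :: s) 1; rewrite /= drop0 -/t => sE.
by rewrite -[in RHS]sE -[[::] in RHS]/(map t [::]) gapsum_map; apply: eq_gapsum.
Qed.

Lemma inf_sum_split kappa kappa' s : inf_sum kappa kappa' s =
  split_sum (fun a y b => gapsum (free_sum kappa) (fun u => free_sum kappa (a ++ u))
    [::] (fun t => kappa' (y :: t)) b) s.
Proof.
pose t := tnth (in_tuple s).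
pose K (V : {set 'I_(size s)}) := kappa (restr V).
pose F (V : {set 'I_(size s)}) := (kappa' \o map t) (enum V) * NC_weight_off K K setT V.
transitivity (\sum_V F V).
  rewrite /inf_sum (exchange_big_dep predT) //=; apply: eq_bigr => V _.
  rewrite /F /= -restrE mulr_sumr; apply: eq_bigr => P _; congr (_ * _).
  by apply: eq_bigr => W _; rewrite /block_weight if_same.
(* The marked blocks are sorted by their first letter; the empty set is a block of no partition, so
   it contributes 0. *)
rewrite split_sumE sum_min_element => [|]; last first.
  rewrite /F /NC_weight_off big1 ?mulr0 // => P /andP[/NConP[/negPf P0 _ _ _ _]].
  by rewrite P0.
apply: eq_bigr => i _; rewrite (@sum_NC_weight_off_min _ _ _ _ i
  (free_sum kappa \o map t) (fun u => free_sum kappa (take i s ++ map t u))).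
- rewrite -[in RHS](map_enum_drop s) -[[::] in RHS]/(map t [::]) gapsum_map.
  exact: eq_gapsum.
- by move=> B; rewrite NC_weight_free_word.
- move=> q iq; rewrite NC_weight_free_diag NC_weight_free_word enum_setU_lt.
    by rewrite map_cat map_enum_take.
  by move=> a b; rewrite !inE => ai qb; rewrite (ltn_trans (leq_trans ai iq)).
- by left.
Qed.

Lemma free_sum_cons kappa x s : free_sum kappa (x :: s) =
  gapsum (free_sum kappa) (free_sum kappa) [::] (fun t => kappa (x :: t)) s.
Proof.
by rewrite -cfree_sum_diag cfree_sum_cons; apply: eq_gapsum => // u; apply: cfree_sum_diag.
Qed.

Lemma NC0 : NC 0 = [set set0].
Proof.
have V0 (V : {set 'I_0}) : V = set0 by apply/setP => -[].
apply/setP => P; rewrite [RHS]inE; apply/idP/eqP => [/NConP[P0 _ _ _ _]|->].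
  apply/setP => V; rewrite inE (V0 V); exact: negbTE.
apply/NConP; split; first by rewrite inE.
- by move=> V W x; rewrite inE.
- by move=> V x; rewrite inE.
- by case.
- by move=> V W a b c d; rewrite inE.
Qed.

Lemma free_sum_nil kappa : free_sum kappa [::] = 1.
Proof. by rewrite /free_sum /= NC0 big_set1 big_set0. Qed.

Lemma cfree_sum_nil kappa kappac : cfree_sum kappa kappac [::] = 1.
Proof. by rewrite cfree_sumE /NC_weight -[NCon _]/(NC 0) NC0 big_set1 big_set0. Qed.

Lemma free_sum0 s : free_sum (fun=> 0) s = (size s == 0)%N%:R :> C.
Proof.
by case: s => [|x s]; rewrite ?free_sum_nil // free_sum_cons gapsum0.
Qed.

(** If [l] lies between two elements of a block but outside it, non-crossing traps the block of [l]
    between them, so that block is inner. Conversely, a consecutive block contains whatever lies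
    between its elements, so it encloses no other block. *)
Lemma IntP_inner n (P : {set {set 'I_n}}) : P \in NC n ->
  (P \in IntP n) = [forall V in P, ~~ inner P V].
Proof.
move=> N; rewrite inE N /=; have /NConP[_ d _ c x] : P \in NCon setT := N.
apply/forall_inP/forall_inP => [cP V VP|oP V VP].
  apply/negP => /(innerP N VP)[W [a [b [WP aW bW avb]]]].
  have [v vV] := NCon_block_mem N VP; have /andP[av vb] := avb v vV.
  have vW : v \in W.
    by have /consecutiveP/(_ a b v aW bW) := cP _ WP; rewrite (ltnW av) (ltnW vb); apply.
  by have := avb a; rewrite (d _ _ v VP WP vV vW) aW ltnn => /(_ isT).
apply/consecutiveP => i j l iV jV /andP[il lj]; apply: contraT => lV.
have [W WP lW] := c l (in_setT l).
have WV : W != V by apply: contraNneq lV => <-.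
have nV w : w \in W -> w \notin V.
  by move=> wW; apply: contra WV => wV; apply/eqP/(d _ _ w).
have lt_neq (a b : 'I_n) : a \in W -> b \in V -> (a <= b)%N -> (a < b)%N.
  move=> aW bV; rewrite leq_eqVlt => /predU1P[/val_inj ab|//].
  by have := nV a aW; rewrite ab bV.
have gt_neq (a b : 'I_n) : a \in W -> b \in V -> (b <= a)%N -> (b < a)%N.
  move=> aW bV; rewrite leq_eqVlt => /predU1P[/val_inj ab|//].
  by have := nV a aW; rewrite -ab bV.
have {}il := gt_neq _ _ lW iV il; have {}lj := lt_neq _ _ lW jV lj.
have /negP[] := oP W WP; apply/(innerP N WP); exists V, i, j; split => // w wW.
apply/andP; split.
  apply: gt_neq => //; rewrite leqNgt; apply/negP => wi.
  by case/eqP: WV; apply: (x W V w i l j); rewrite ?wi.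
apply: lt_neq => //; rewrite leqNgt; apply/negP => jw.
by case/eqP: WV; apply/esym; apply: (x V W i l j w); rewrite ?il.
Qed.

(** Zero weight on inner blocks kills every partition that is not an interval partition, so the
    Boolean expansion is an instance of the c-free one. *)
Lemma bool_sumE (beta : seq T -> C) s : bool_sum beta s = cfree_sum (fun=> 0) beta s.
Proof.
rewrite /bool_sum (eq_bigl (fun P => (P \in NC (size s)) && (P \in IntP (size s)))).
  rewrite big_mkcondr; apply: eq_bigr => P N; rewrite IntP_inner //.
  case: ifP => [/forall_inP oP|/negbT].
    rewrite [X in _ = X * _]big1 ?mul1r => [|V /andP[/oP /negPf->//]].
    by apply: eq_bigl => V; rewrite /outer andb_idr // => /oP.
  rewrite negb_forall => /existsP[V]; rewrite negb_imply negbK => iV.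
  by rewrite (bigD1 V) //= mul0r mul0r.
by move=> P; rewrite andb_idl // inE => /andP[].
Qed.

(** Exactly one block contains [l], so taking it as the marked block loses no partition and counts
    none twice. *)
Lemma free_sum_marked kappa (p : pred T) s (l : 'I_(size s)) :
  (forall i, p (tnth (in_tuple s) i) = (i == l)) ->
  free_sum kappa s = inf_sum kappa (fun t => if has p t then kappa t else 0) s.
Proof.
move=> pE; apply: eq_bigr => P N.
have /NConP[_ d _ c _] : P \in NCon setT := N.
have [V VP lV] := c l (in_setT l).
have hasE W : has p (restr W) = (l \in W).
  rewrite restrE has_map -(mem_enum W) -has_pred1; apply: eq_has => i /=.
  by rewrite pE.
rewrite (bigD1 V) //= [RHS](bigD1 V) //= hasE lV [X in _ + X]big1 ?addr0 // => W.
case/andP=> WP WV; rewrite hasE ifN ?mul0r //.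
by apply: contra WV => lW; apply/eqP/(d _ _ l).
Qed.

End Words.

Lemma free_sum_rcons (C : comNzRingType) (T : Type) (kappa : seq T -> C) s x :
  free_sum kappa (rcons s x) =
  gapsum (free_sum kappa) (free_sum kappa) [::] (fun t => kappa (rcons t x)) s.
Proof.
(* Letters may repeat, so each carries a flag, raised only at the last position, which lets a
   predicate on letters single out that position. *)
pose g y := (y : T, false).
have gK t : map fst (map g t) = t by rewrite -map_comp map_id.
pose w := rcons (map g s) (x, true).
have wE : rcons s x = map fst w by rewrite map_rcons gK.
have lw : (size s < size w)%N by rewrite size_rcons size_map.
rewrite wE free_sum_map (@free_sum_marked _ _ _ snd _ (Ordinal lw)) => [|i].
  rewrite inf_sum_split marked_split_sum ?free_sum_nil //; last first.
    by rewrite has_map; elim: (s).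
  rewrite -[[::] in LHS]/(map g [::]) gapsum_map; apply: eq_gapsum => t /=.
  - by rewrite -free_sum_map gK.
  - by rewrite -free_sum_map gK.
  - by rewrite map_rcons gK.
rewrite (tnth_nth (x, true)) nth_rcons size_map -val_eqE /=.
case: ltngtP => [i_s|s_i|//]; first by rewrite (nth_map x).
have iw := ltn_ord i; rewrite [X in (_ < X)%N]size_rcons size_map ltnS in iw.
by rewrite leqNgt s_i in iw.
Qed.

(** * Cumulants on words *)

Section WordCumulants.
Variables (C : comNzRingType) (k : nat).
Local Notation X := (@ncX C k).
Implicit Types (mu nu : Dalg C k) (w : seq 'I_k).

Definition word_moment (f : Dalg C k) w := f (\prod_(i <- w) X i).

Lemma word_moment_nil mu : word_moment mu [::] = 1.
Proof. by rewrite /word_moment big_nil dalg1. Qed.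

Lemma word_moment_free mu : word_moment mu =1 free_sum (free_cumulant mu \o map X).
Proof.
case=> [|i w]; first by rewrite word_moment_nil free_sum_nil.
by rewrite /word_moment -prod_map_X (free_cumulantP mu).2 // free_sum_map.
Qed.

Lemma word_moment_cfree mu nu : word_moment nu =1
  cfree_sum (free_cumulant mu \o map X) (cfree_cumulant mu nu \o map X).
Proof.
case=> [|i w]; first by rewrite word_moment_nil cfree_sum_nil.
by rewrite /word_moment -prod_map_X (cfree_cumulantP mu nu).2 // cfree_sum_map.
Qed.

Lemma word_moment_bool nu : word_moment nu =1
  cfree_sum (fun=> 0) (bool_cumulant nu \o map X).
Proof.
case=> [|i w]; first by rewrite word_moment_nil cfree_sum_nil.
by rewrite /word_moment -prod_map_X (bool_cumulantP nu).2 // bool_sumE cfree_sum_map.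
Qed.

(* Cyclic invariance on words, which is what remains of traciality. *)
Definition word_cyclic mu := forall i w, word_moment mu (i :: w) = word_moment mu (rcons w i).

Lemma tracial_word_cyclic mu : tracial mu -> word_cyclic mu.
Proof.
by move=> mu_tr i w; rewrite /word_moment big_cons mu_tr big_rcons /=.
Qed.

Lemma word_cyclicP mu : word_cyclic mu <->
  forall i w, free_cumulant mu (map X (i :: w)) = free_cumulant mu (map X (rcons w i)).
Proof.
pose K := free_cumulant mu \o map X.
have K1 : free_sum K [::] = 1 by apply: free_sum_nil.
have Kc i w := free_sum_cons K i w; have Kr i w := free_sum_rcons K w i.
split=> [mc i w|kc i w].
  apply: (cyclic_moments_cumulants K1 Kc Kr) => j v.
  by rewrite -!word_moment_free.
rewrite !word_moment_free; exact: (cyclic_cumulants_moments Kc Kr).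
Qed.

Lemma boxplus_word_cyclic mu1 mu2 :
  word_cyclic mu1 -> word_cyclic mu2 -> word_cyclic (boxplus mu1 mu2).
Proof.
move=> /word_cyclicP c1 /word_cyclicP c2; apply/word_cyclicP => i w.
by rewrite !boxplusP ?size_rcons // c1 c2.
Qed.

Lemma bool_cumulant_word mu nu i w :
  bool_cumulant nu (map X (i :: rcons w i)) =
  gapsum (word_moment mu) (word_moment mu) [::]
    (fun t => cfree_cumulant mu nu (map X (i :: rcons t i))) w.
Proof.
apply: (bool_cumulant_irreducible (M := word_moment mu) (N := word_moment nu)
  (c := cfree_cumulant mu nu \o map X) (beta := bool_cumulant nu \o map X)).
- exact: word_moment_nil.
- exact: word_moment_nil.
- move=> j s; rewrite (word_moment_cfree mu) cfree_sum_cons.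
  apply: eq_gapsum => // t; first by rewrite word_moment_free.
  by rewrite (word_moment_cfree mu).
- move=> j s; rewrite word_moment_bool cfree_sum_cons.
  apply: eq_gapsum => // t; first exact: free_sum0.
  by rewrite word_moment_bool.
Qed.

(** By uniqueness of infinitesimal cumulants on words, it is enough that the rotation sum reproduces
    the moments of [Psi nu]; [rotation_gapsum] matches the two expansions, and this is where [mu]
    must be cyclic. *)
Lemma inf_cumulant_Psi mu nu w : word_cyclic mu -> (0 < size w)%N ->
  inf_cumulant mu (Psi nu) (map X w) =
  rotation_sum (cfree_cumulant mu nu \o map X) w.
Proof.
move=> mc; pose K := free_cumulant mu \o map X.
move: w; apply: (triangular_unique (inf_sum_triangular K)
  (kappa := inf_cumulant mu (Psi nu) \o map X)) => w w0.
rewrite -inf_sum_map -(inf_cumulantP mu (Psi nu)).2 ?size_map // prod_map_X PsiP //.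
rewrite inf_sum_split.
rewrite (@eq_split_sum _ _ _ (fun a y b => gapsum (word_moment mu)
  (fun u => word_moment mu (a ++ u)) [::]
  (fun t => rotation_sum (cfree_cumulant mu nu \o map X) (y :: t)) b)); last first.
  by move=> a y b _; apply: eq_gapsum => // u; rewrite word_moment_free.
rewrite -rotation_gapsum; last exact: cyclic_cat.
(* The words [drop m w] and [take m.+1 w] share the letter at position [m], which therefore stands
   at both ends of the Boolean cumulant. *)
rewrite split_sumE; apply: eq_bigr => m _.
have i0 : 'I_k := tnth (in_tuple w) m.
rewrite -(bool_cumulant_word mu nu) (tnth_nth i0) /= -map_cat.
by rewrite (drop_nth i0) // (take_nth i0) //= rcons_cat.
Qed.

End WordCumulants.

Theorem theorem1p2 (R : realType) (k : nat) (k_gt0 : (0 < k)%N)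
    (mu1 nu1 mu2 nu2 mu nu : Dalg R[i] k)
    (mu1_tracial : tracial mu1) (mu2_tracial : tracial mu2) :
  boxplus_c (mu1, nu1) (mu2, nu2) = (mu, nu) ->
  boxplus_B (mu1, Psi nu1) (mu2, Psi nu2) = (mu, Psi nu).
Proof.
move=> E; have muE : mu = boxplus mu1 mu2 by rewrite -[mu]/(mu, nu).1 -E.
have nuP : is_boxplus_c mu1 nu1 mu2 nu2 nu.
  by have := boxplus_cP (mu1, nu1) (mu2, nu2); rewrite E.
have c1 := tracial_word_cyclic mu1_tracial.
have c2 := tracial_word_cyclic mu2_tracial.
have c12 := boxplus_word_cyclic c1 c2.
rewrite [LHS]surjective_pairing muE; congr pair.
apply/esym/boxplus_B_unique => w w0 /=.
(* Rotation sums are linear in the c-free cumulants, which add on each rotated word. *)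
rewrite !inf_cumulant_Psi // /rotation_sum -split_sumD; apply: eq_split_sum => a y b _.
exact: nuP.
Qed.
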